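(* Let there be given Hilbert spaces $H_x$ of entire functions (indexed by a real parameter $x$), with entire functions $A_x$ (even, real on the real line) and $B_x$ (odd, real on the real line) such that the evaluators $Z_z$ in $H_x$ are given by $$Z_z(w)=(Z_w,Z_z)=2\,\frac{\overline{B_x(z)}A_x(w)-\overline{A_x(z)}B_x(w)}{\overline z-w},$$ and whose variations with respect to $x$ are given, with a real valued function $\mu(x)$, by $$\frac{d}{dx}A_x(w)-\mu(x)A_x(w)=-wB_x(w),\qquad \frac{d}{dx}B_x(w)+\mu(x)B_x(w)=wA_x(w).$$ Let $\sigma=(z_1,\dots,z_n)$ be a finite sequence of purely imaginary numbers, with $z_i\ne z_j$ for $i\neq j$ and $z_i\ne -z_j$ for all $1\le i,j\le n$, the associated evaluators in $H_x$ being supposed linearly independent, and let $H_x(\sigma)$ be the Hilbert space $H_x$ modified by $\sigma$. Then its evaluators $\mathcal K_z$ are given by $$\mathcal K_z(w)=(\mathcal K_w,\mathcal K_z)=2\,\frac{\overline{\mathcal B_{x,\sigma}(z)}\mathcal A_{x,\sigma}(w)-\overline{\mathcal A_{x,\sigma}(z)}\mathcal B_{x,\sigma}(w)}{\overline z-w}$$ with $$\mathcal A_{x,\sigma}(w)=\gamma(w)\gamma(-w)\frac{W(A_x(z_1),\dots,A_x(z_n),A_x(w))}{W(A_x(z_1),\dots,A_x(z_n))},$$ $$\mathcal B_{x,\sigma}(w)=\gamma(w)\gamma(-w)\frac{W(B_x(z_1),\dots,B_x(z_n),B_x(w))}{W(B_x(z_1),\dots,B_x(z_n))},$$ where the Wronskians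 involve derivatives with respect to $x$. The entire functions $\mathcal A_{x,\sigma}$ and $\mathcal B_{x,\sigma}$ are real on the real line, and respectively even and odd.
   Context: Scalar products are conjugate linear in the first factor and linear in the second. For a Hilbert space $H$ of entire functions with continuous evaluations, the evaluator $Z_z\in H$ is the vector with $f(z)=(Z_z,f)$ for all $f\in H$. Quotients by $\overline z-w$ are understood at $w=\overline z$ by continuity. $\gamma(w)=\prod_{1\le i\le n}\frac1{w-z_i}$. The modified space is $H_x(\sigma)=\{\gamma f: f\in H_x,\ f(z_1)=\dots=f(z_n)=0\}$, with the Hilbert space structure for which $f\mapsto\gamma f$ is an isometry from the closed subspace of $H_x$ of functions vanishing on $\sigma$; it is again a Hilbert space of entire functions with continuous evaluations, with evaluators $\mathcal K_z$. $W(f_1,\dots,f_m)=\det(f_j^{(i-1)})_{1\le i,j\le m}$ (derivatives with respect to $x$). Functions of $x$ are tacitly assumed smooth enough for the Wronskians to make sense. *)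

(* Defs.v *)
(* MathComp / MathComp-Analysis; the complex numbers are R[i] over R : realType. *)
From mathcomp Require Export all_boot all_order all_algebra.
From mathcomp Require Export complex.
From mathcomp Require Export all_classical all_reals all_analysis.
Set Implicit Arguments.
Unset Strict Implicit.
Unset Printing Implicit Defensive.
Import Order.TTheory GRing.Theory Num.Theory.
Import numFieldNormedType.Exports.
Local Open Scope classical_set_scope.
Local Open Scope ring_scope.
Local Open Scope complex_scope.

Section EntireFunctions.
Context {R : realType}.
Local Notation C := R[i].
Implicit Types (f g : C -> C) (w z : C).

(* The topology of C, and complex differentiability, are carried by C^o. *)
Definition entire f : Prop :=
  forall z, derivable (f : C^o -> C^o) (z : C^o) 1.

Definition real_on_reals f : Prop := forall t : R, complex.Im (f t%:C) = 0.

Definition even_fct f : Prop := forall w, f (- w) = f w.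

Definition odd_fct f : Prop := forall w, f (- w) = - f w.

(* Removes the singularities of f located at the points of S: there the value
   is the limit over the punctured neighbourhood.  Division by zero is total,
   so the value f itself takes on S carries no information. *)
Definition fill (S : pred C) f : C -> C := fun w =>
  if S w then lim ((f : C^o -> C^o) w' @[w' --> (w : C^o)^']) else f w.

End EntireFunctions.

Section FunctionSpaces.
Context {R : realType}.
Local Notation C := R[i].
Implicit Types (f g h k : C -> C) (w z c : C).

(* The scalar product is only meaningful on the domain. *)
Record fspace := FSpace {
  fdom : set (C -> C);
  fprod : (C -> C) -> (C -> C) -> C }.

Implicit Types H : fspace.

Definition fnorm H f : R := Num.sqrt (complex.Re (fprod H f f)).

(* Scalar products are conjugate linear in the first factor. *)
Record hilbert_entire H : Prop := HilbertEntire {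
  dom_entire : forall f, fdom H f -> entire f;
  dom0 : fdom H (fun=> 0);
  domD : forall f g, fdom H f -> fdom H g -> fdom H (f \+ g);
  domZ : forall c f, fdom H f -> fdom H (fun w => c * f w);
  fprodDr : forall f g h, fdom H f -> fdom H g -> fdom H h ->
    fprod H f (g \+ h) = fprod H f g + fprod H f h;
  fprodZr : forall c f g, fdom H f -> fdom H g ->
    fprod H f (fun w => c * g w) = c * fprod H f g;
  fprod_conj : forall f g, fdom H f -> fdom H g ->
    fprod H g f = (fprod H f g)^*;
  fprod_ge0 : forall f, fdom H f -> 0 <= fprod H f f;
  fprod_eq0 : forall f, fdom H f -> fprod H f f = 0 -> f = (fun=> 0);
  fcomplete : forall u : nat -> C -> C, (forall n, fdom H (u n)) ->
    (forall e : R, 0 < e -> exists N, forall m n, (N <= m)%N -> (N <= n)%N ->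
       fnorm H (u m \- u n) < e) ->
    exists2 f, fdom H f & fnorm H (u n \- f) @[n --> \oo] --> (0 : R);
  eval_continuous : forall z (e : R), 0 < e ->
    exists2 d : R, 0 < d & forall f g, fdom H f -> fdom H g ->
      fnorm H (f \- g) < d -> `|f z - g z| < e%:C }.

(* K z is the evaluator at z. *)
Definition evaluators H (K : C -> C -> C) : Prop :=
  (forall z, fdom H (K z)) /\
  (forall z f, fdom H f -> f z = fprod H (K z) f).

(* z is conjugated; the value at w = z^* is defined by continuity. *)
Definition dbkernel (A B : C -> C) z : C -> C :=
  fill (pred1 z^*)
    (fun w => 2 * ((B z)^* * A w - (A z)^* * B w) / (z^* - w)).

Definition linearly_independent n (F : 'I_n -> C -> C) : Prop :=
  forall c : 'I_n -> C,
    (forall w, \sum_(i < n) c i * F i w = 0) -> forall i, c i = 0.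

Section Modification.
Variables (n : nat) (s : 'I_n -> C).

Definition gam w : C := \prod_(i < n) (w - s i)^-1.

Definition on_sigma : pred C := fun w => [exists i, w == s i].

(* As an entire function, i.e. with the removable singularities removed. *)
Definition gam_mul f : C -> C := fill on_sigma (fun w => gam w * f w).

(* Inverse of gam_mul on the functions vanishing at the s i: see gam_mulK. *)
Definition gam_div g : C -> C := fun w => g w * \prod_(i < n) (w - s i).

Definition modified H : fspace := FSpace
  (gam_mul @` [set f | fdom H f /\ forall i, f (s i) = 0])
  (fun F G => fprod H (gam_div F) (gam_div G)).

Lemma gam_mulK f : (forall i, f (s i) = 0) -> gam_div (gam_mul f) = f.
Proof.
move=> f0; apply/funext => w; rewrite /gam_div /gam_mul /fill.
case: ifPn => [/existsP[i /eqP ->]|/existsPn wNs].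
  by rewrite (bigD1 i)//= subrr mul0r mulr0 f0.
rewrite mulrAC /gam -big_split/= big1 ?mul1r// => i _.
by rewrite mulVf// subr_eq0 wNs.
Qed.

Lemma modified_isometry H f g :
  (forall i, f (s i) = 0) -> (forall i, g (s i) = 0) ->
  fprod (modified H) (gam_mul f) (gam_mul g) = fprod H f g.
Proof. by move=> f0 g0; rewrite /= !gam_mulK. Qed.

End Modification.
End FunctionSpaces.

Arguments fspace R : clear implicits.

Section Wronskians.
Context {R : realType}.
Local Notation C := R[i].
Implicit Types (f : R -> C) (x : R).

(* A complex-valued function of a real variable is differentiated
   componentwise. *)
Definition derivableC f x : Prop :=
  derivable (fun t => complex.Re (f t)) x 1 /\
  derivable (fun t => complex.Im (f t)) x 1.

Definition deriveC f : R -> C := fun x =>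
  derive1 (fun t => complex.Re (f t)) x +i* derive1 (fun t => complex.Im (f t)) x.

Definition derivableC_upto n (I : set R) f : Prop :=
  forall k, (k < n)%N -> forall x, I x -> derivableC (iter k deriveC f) x.

Definition wronskian m (f : 'I_m -> R -> C) x : C :=
  \det (\matrix_(i < m, j < m) iter i deriveC (f j) x).

(* The sequence (s 0, ..., s (n - 1), w). *)
Definition append n (s : 'I_n -> C) (w : C) : 'I_n.+1 -> C :=
  fun j => if unlift ord_max j is Some i then s i else w.

Definition wronskian_of m (F : R -> C -> C) (s : 'I_m -> C) x : C :=
  wronskian (fun j t => F t (s j)) x.

(* The transform of A (resp. B) at x, with its removable singularities at the
   points s i and - s i removed. *)
Definition transformed n (s : 'I_n -> C) (F : R -> C -> C) x : C -> C :=
  fill (fun w => on_sigma s w || on_sigma s (- w))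
    (fun w => gam s w * gam s (- w) *
       (wronskian_of F (append s w) x / wronskian_of F s x)).

End Wronskians.

(* Main.v *)
Require Import Defs.
From mathcomp Require Import ring zify.

(** Fix [x] and write [A], [B] for [A x], [B x].  Let [e_0 = A], [e_1 = - w B],
[e_2 = - w ^ 2 A], [e_3 = w ^ 3 B], and so on: what the repeated derivatives of
[A] would be if [mu] were zero.  The differential system gives
[e_j' = (-1) ^ j mu e_j + e_(j+1)], so the successive derivatives of [A] are
obtained from the [e_j] by a unipotent triangular matrix which depends on [x]
but not on [w].  Hence a Wronskian of [A] is the determinant of the values of
the [e_j] ([wronskian_chain]); this uses that [mu] is differentiable often
enough, which holds because [mu] is a quotient of values at a point of sigma.
The derivatives in [x] have now disappeared.  The pair [(B, - A)] obeys the
same system with [- mu] in place of [mu] and has the same kernel, so whatever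
is shown for [A] holds for [B] too.

At fixed [x] the ratio of determinants is a function [N_A = P A + Q B] where [P]
and [Q] are polynomials in [w] with real coefficients, of degree at most [n],
and [N_A] vanishes at every point [z_i] and, by parity, at every [- z_i].
Likewise [N_B = T B - T2 A].  The polynomial [P T + Q T2] is monic of degree
[2 n] and vanishes at the same [2 n] points, so it is their nodal polynomial.
Lagrange interpolation at the conjugates of [z_1, ..., z_n, z] turns the
numerator of the new kernel, a combination of [A] and [B] with polynomial
coefficients of degree at most [n], into a combination of the evaluators of
these points: a coefficient vector which annihilates [(A, B)] at the conjugate
of [u] is a multiple of the one defining the evaluator at [u]
([partial_fractions]).  The nodal polynomial gives the coefficient of the
evaluator at [z], and one gets ([numerator_decomp], [gam_div_kernel_decomp])

  [K_z (w) * prod (w - z_i) = conj (gamma z) Z_z (w) + sum a_i Z_(z_i) (w)].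

The right-hand side is in [H], its left-hand form vanishes on sigma, and its
product with a function [f] vanishing on sigma is [gamma z * f z]: this is the
reproducing property of the modified space.  The same interpolation, at the
points [z_1, ..., z_n] alone, shows that the determinants in the denominators
are not zero: a linear relation between their rows would give a combination of the
evaluators of sigma vanishing on sigma, hence orthogonal to itself
([det_echain_mx]).

When [z] is one of the points [z_i], [- z_i] the formula degenerates, and [K_z]
is reached as the limit of the evaluators at [z + 1 / (k + 1)].  They form a
Cauchy sequence because their Gram matrix consists of values of the kernel,
which is continuous near [(z, z)] since [z] is not its own conjugate
([gam_div_kernel_limit]).

The removable singularities are controlled by the space itself.  The evaluators
belong to [H], hence are entire, and they are divided
differences of [A] and [B]; every quotient that has to be differentiable is a
multiple of an evaluator plus an explicitly divisible term
([linear_combination_quotient]).  In the same way the relation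
[conj (B z) * A (conj z) = conj (A z) * B (conj z)], which replaces the
reflection principle, is the continuity of [Z_z] at [conj z]
([dbnum_conj_eq0]). *)

Import Order.TTheory GRing.Theory Num.Theory.
Import numFieldNormedType.Exports.
Local Open Scope classical_set_scope.
Local Open Scope ring_scope.
Local Open Scope complex_scope.
Set Implicit Arguments.
Unset Strict Implicit.
Unset Printing Implicit Defensive.

(** * Continuity and complex differentiability at a point *)

Section ComplexContinuity.
Local Open Scope ring_scope.
Context {R : realType}.
Local Notation C := R[i].
Implicit Types (f g q : C -> C) (w z p : C).

Definition cont_at f w : Prop :=
  (f : C^o -> C^o) w' @[w' --> (w : C^o)] --> (f w : C^o).

Definition cderivable f w : Prop := derivable (f : C^o -> C^o) (w : C^o) 1.

Lemma cvg_conj T (F : set_system T) {FF : Filter F} (u : T -> C) (l : C) :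
  (u : T -> C^o) t @[t --> F] --> (l : C^o) ->
  ((u t)^* : C^o) @[t --> F] --> (l^* : C^o).
Proof.
move=> /cvgrPdist_lt ul; apply/cvgrPdist_lt => e /ul.
by apply: filterS => t; rewrite -rmorphB norm_conjC.
Qed.

(** Neighbourhoods of a complex number through plain balls; the radius is a
positive complex number because the norm is complex-valued. *)
Lemma nearcP w (P : C -> Prop) : (\forall w' \near (w : C^o), P w') <->
  exists2 d : C, 0 < d & forall w', `|w - w'| < d -> P w'.
Proof.
split=> [/(@nbhs_ballP _ C^o)[d d0 H]|[d d0 H]].
  by exists d => // w' h; exact: H.
by apply/(@nbhs_ballP _ C^o); exists d => // w' h; exact: H.
Qed.

Lemma dnearcP w (P : C -> Prop) : (\forall w' \near (w : C^o)^', P w') <->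
  exists2 d : C, 0 < d & forall w', w' != w -> `|w - w'| < d -> P w'.
Proof.
rewrite /dnbhs /within /=; split=> [/nearcP[d d0 H]|[d d0 H]].
  by exists d => // w' nw h; exact: H.
by apply/nearcP; exists d => // w' h nw; exact: H.
Qed.

Lemma cont_atP f w : cont_at f w <->
  forall e : C, 0 < e -> exists2 d : C, 0 < d &
    forall w', `|w - w'| < d -> `|f w - f w'| < e.
Proof.
rewrite /cont_at; split=> [fw e e0|H].
  exact/nearcP/(cvgr_dist_lt _ _ fw _ e0).
by apply/(@cvgrPdist_lt C C^o _ _ (nbhs_filter _)) => e /H/nearcP.
Qed.

(** Caratheodory's form of differentiability: it turns a removable quotient
into a continuous function without any limit of difference quotients. *)
Lemma cderivable_quot f w : cderivable f w ->
  exists2 q, cont_at q w & forall w', f w' = f w + (w' - w) * q w'.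
Proof.
rewrite /cderivable /derivable => /cvg_ex[/= l fl].
pose q w' := if w' == w then l else (f w' - f w) / (w' - w).
exists q; last first.
  move=> w'; rewrite /q; case: eqVneq => [->|ww']; first by rewrite subrr mul0r addr0.
  by rewrite mulrC divfK ?subr_eq0// addrC subrK.
apply/cont_atP => e e0; have /dnearcP[d d0 H] := @cvgr_dist_lt C C^o _ _ (dnbhs_filter _) _ _ fl e e0.
exists d => //= w' ww'.
rewrite /q eqxx; case: eqVneq => [_|nw]; first by rewrite subrr normr0.
have := H (w' - w); rewrite sub0r normrN subr_eq0 => /(_ nw).
rewrite distrC in ww'; move=> /(_ ww').
by rewrite /GRing.scale /= mulr1 subrK mulrC.
Qed.

Lemma cderivable_cont f w : cderivable f w -> cont_at f w.
Proof.
move=> fw; apply: differentiable_continuous; exact/derivable1_diffP.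
Qed.

(** Used to transport identities across the points where a formula divides by
zero. *)
Lemma eq_punctured f g w : cont_at f w -> cont_at g w ->
  (\forall w' \near (w : C^o)^', f w' = g w') -> f w = g w.
Proof.
move=> fw gw fg.
have fw' : (f : C^o -> C^o) w' @[w' --> (w : C^o)^'] --> (f w : C^o).
  exact: cvg_trans (cvg_app _ (@nbhs_dnbhs _ _)) fw.
have gw' : (g : C^o -> C^o) w' @[w' --> (w : C^o)^'] --> (g w : C^o).
  exact: cvg_trans (cvg_app _ (@nbhs_dnbhs _ _)) gw.
have h : (g : C^o -> C^o) w' @[w' --> (w : C^o)^'] --> (f w : C^o).
  exact: cvg_trans (near_eq_cvg fg) fw'.
have P := @Proper_dnbhs_regular_numFieldType C w.
exact: (cvg_unique (@norm_hausdorff C C^o) h gw').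
Qed.

Lemma near_neq w p : w != p -> \forall w' \near (w : C^o), w' != p.
Proof.
move=> wp; apply/nearcP; exists `|w - p|; first by rewrite normr_gt0 subr_eq0.
by move=> w'; apply: contraTneq => ->; rewrite ltxx.
Qed.

Lemma cont_at_near f g w : cont_at f w ->
  (\forall w' \near (w : C^o), f w' = g w') -> cont_at g w.
Proof.
move=> fw fg; rewrite /cont_at -(nbhs_singleton fg).
exact: cvg_trans (near_eq_cvg fg) fw.
Qed.

Lemma cderivable_near f g w : cderivable f w ->
  (\forall w' \near (w : C^o), f w' = g w') -> cderivable g w.
Proof. by move=> fw fg; apply: near_eq_derivable fw. Qed.

Lemma cderivableD f g w : cderivable f w -> cderivable g w ->
  cderivable (fun w' => f w' + g w') w.
Proof. exact: derivableD. Qed.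

Lemma cderivableM f g w : cderivable f w -> cderivable g w ->
  cderivable (fun w' => f w' * g w') w.
Proof. exact: derivableM. Qed.

Lemma cderivableV f w : f w != 0 -> cderivable f w ->
  cderivable (fun w' => (f w')^-1) w.
Proof. exact: derivableV. Qed.

Lemma cderivable_cst c w : cderivable (fun=> c) w.
Proof. exact: derivable_cst. Qed.

Lemma cderivable_id w : cderivable id w.
Proof. exact: derivable_id. Qed.

Lemma cderivable_prod (T : Type) (r : seq T) (F : T -> C -> C) w :
  (forall i, cderivable (F i) w) -> cderivable (fun w' => \prod_(i <- r) F i w') w.
Proof.
move=> Fd; elim: r => [|i r IH].
  have -> : (fun w' => \prod_(i <- [::]) F i w') = fun=> 1.
    by apply/funext => ?; rewrite big_nil.
  exact: cderivable_cst.
have -> : (fun w' => \prod_(j <- i :: r) F j w')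
        = fun w' => F i w' * \prod_(j <- r) F j w'.
  by apply/funext => ?; rewrite big_cons.
exact: (cderivableM (Fd i) IH).
Qed.

Lemma cderivable_horner (p : {poly C}) w : cderivable (horner p) w.
Proof.
elim/poly_ind: p => [|p c IH].
  have -> : horner (0 : {poly C}) = fun=> 0 by apply/funext => ?; rewrite horner0.
  exact: cderivable_cst.
have -> : horner (p * 'X + c%:P) = fun x => p.[x] * x + c.
  by apply/funext => ?; rewrite !hornerE.
exact: (cderivableD (cderivableM IH (@cderivable_id w)) (@cderivable_cst c w)).
Qed.

Lemma cont_at_cst c w : cont_at (fun=> c) w.
Proof. exact: (cderivable_cont (@cderivable_cst c w)). Qed.

Lemma cont_atB f g w : cont_at f w -> cont_at g w ->
  cont_at (fun w' => f w' - g w') w.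
Proof. by move=> fw gw; exact: (cvgB fw gw). Qed.

Lemma cont_atM f g w : cont_at f w -> cont_at g w ->
  cont_at (fun w' => f w' * g w') w.
Proof. by move=> fw gw; exact: (cvgM fw gw). Qed.

Lemma cont_at_opp f w : cont_at f (- w) -> cont_at (fun w' => f (- w')) w.
Proof.
move=> /cont_atP fw; apply/cont_atP => e /fw[d d0 h]; exists d => // w' ww'.
by apply: h; rewrite -opprD normrN.
Qed.

Lemma cont_at_conj f w : cont_at f w^* -> cont_at (fun w' => f w'^*) w.
Proof.
move=> /cont_atP fw; apply/cont_atP => e /fw[d d0 h]; exists d => // w' ww'.
by apply: h; rewrite -rmorphB norm_conjC.
Qed.

Lemma cont_conj f w : cont_at f w -> cont_at (fun w' => (f w')^*) w.
Proof. by move=> fw; exact: (cvg_conj fw). Qed.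

(** [fill S f] only looks at [f] near a point [p] of [S], so a continuous
function agreeing with [f] around [p] computes it, at [p] included. *)
Lemma fill_near (S : pred C) f q p : S p -> cont_at q p ->
  (\forall w' \near (p : C^o)^', ~~ S w' /\ f w' = q w') ->
  \forall w' \near (p : C^o), fill S f w' = q w'.
Proof.
move=> Sp qp fq.
have fp : fill S f p = q p.
  rewrite /fill Sp; have P := @Proper_dnbhs_regular_numFieldType C p.
  apply: (@cvg_lim C^o (@norm_hausdorff C C^o)).
  apply: cvg_trans (cvg_trans (cvg_app _ (@nbhs_dnbhs _ _)) qp).
  have e : \forall w' \near (p : C^o)^', q w' = f w'.
    by apply: filterS fq => ? [].
  exact: (near_eq_cvg e).
move/dnearcP: fq => [d d0 H]; apply/nearcP; exists d => // w' w'd.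
have [->//|nw] := eqVneq w' p.
by have [/negbTE nS e] := H _ nw w'd; rewrite /fill nS.
Qed.

End ComplexContinuity.

(** * Removable singularities at finitely many simple poles *)

Section RemovableSingularities.
Local Open Scope ring_scope.
Context {R : realType}.
Local Notation C := R[i].
Implicit Types (f g q N : C -> C) (w z p c : C) (r : seq C).

Lemma near_notin r p : p \notin r -> \forall w \near (p : C^o), w \notin r.
Proof.
elim: r => [|a r IH]; first by move=> _; apply/nearcP; exists 1.
rewrite inE negb_or => /andP[pa /IH pr].
apply: filterS2 (near_neq pa) pr => w wa wr.
by rewrite inE negb_or wa.
Qed.

(** A finite set accumulates nowhere, not even at its own points. *)
Lemma dnear_notin r p : \forall w \near (p : C^o)^', w \notin r.
Proof.
have : p \notin rem p (undup r) by rewrite mem_rem_uniqF ?undup_uniq.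
move=> /near_notin/nearcP[d d0 H]; apply/dnearcP; exists d => // w wp /H.
by rewrite mem_rem_uniq ?undup_uniq// !inE wp mem_undup.
Qed.

Lemma prodV_cderivable r w : w \notin r ->
  cderivable (fun w' => \prod_(a <- r) (w' - a)^-1) w.
Proof.
elim: r => [|a r IH].
  have -> : (fun w' => \prod_(a <- [::]) (w' - a)^-1) = fun=> 1 :> C.
    by apply/funext => ?; rewrite big_nil.
  by move=> _; exact: cderivable_cst.
rewrite inE negb_or => /andP[wa /IH wr].
have -> : (fun w' => \prod_(b <- a :: r) (w' - b)^-1)
        = fun w' => (w' - a)^-1 * \prod_(b <- r) (w' - b)^-1 :> C.
  by apply/funext => ?; rewrite big_cons.
apply: cderivableM wr; apply: cderivableV; first by rewrite subr_eq0.
exact: (cderivableD (@cderivable_id _ w) (@cderivable_cst _ (- a) w)).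
Qed.

(** A function whose only singularities are simple poles at the distinct points
of [r], where the numerator [N] vanishes. *)
Section Fill.
Variables (r : seq C) (S : pred C) (c : C) (N f : C -> C).
Hypotheses (r_uniq : uniq r) (S_r : S =i mem r)
  (f_def : forall w, w \notin r -> f w = c * \prod_(a <- r) (w - a)^-1 * N w).

Let nS w : ~~ S w = (w \notin r). Proof. by rewrite -(S_r w). Qed.

Lemma fill_prodV_off w : w \notin r ->
  \forall w' \near (w : C^o), c * \prod_(a <- r) (w' - a)^-1 * N w' = fill S f w'.
Proof.
move=> /near_notin; apply: filterS => w' wr.
by rewrite /fill ifN ?nS// f_def.
Qed.

(** The factor [w - p] of the numerator cancels the only singular factor of the
denominator, since the other poles are distinct from [p]. *)
Lemma fill_prodV_on p g : p \in r -> cont_at g p ->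
  (forall w, N w = (w - p) * g w) ->
  \forall w' \near (p : C^o),
    fill S f w' = c * \prod_(a <- rem p r) (w' - a)^-1 * g w'.
Proof.
move=> pr gp Ng; apply: fill_near; first by rewrite -[S p]/(p \in S) S_r.
  apply: cont_atM gp; apply: cont_atM; first exact: cont_at_cst.
  by apply/cderivable_cont/prodV_cderivable; rewrite mem_rem_uniqF.
have /dnearcP[d d0 H] := dnear_notin r p; apply/dnearcP; exists d => // w wp /H.
move=> /(_ wp) wr; rewrite nS; split => //.
rewrite f_def// Ng (perm_big _ (perm_to_rem pr)) /= big_cons.
by rewrite -!mulrA; congr (c * _); rewrite mulrCA mulKf// subr_eq0.
Qed.

Lemma fill_prodV_cont : (forall w, cont_at N w) ->
  (forall p, p \in r -> exists2 g, cont_at g p & forall w, N w = (w - p) * g w) ->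
  forall w, cont_at (fill S f) w.
Proof.
move=> Nc Np w; have [wr|wr] := boolP (w \in r).
  have [g gw Ng] := Np _ wr.
  apply: cont_at_near; last first.
    by apply: filterS (fill_prodV_on wr gw Ng) => ? ->.
  apply: cont_atM gw; apply: cont_atM; first exact: cont_at_cst.
  by apply/cderivable_cont/prodV_cderivable; rewrite mem_rem_uniqF.
apply: cont_at_near (fill_prodV_off wr).
apply: cont_atM (Nc w); apply: cont_atM; first exact: cont_at_cst.
exact/cderivable_cont/prodV_cderivable.
Qed.

Lemma fill_prodV_entire : entire N ->
  (forall p, p \in r -> exists2 g, cderivable g p & forall w, N w = (w - p) * g w) ->
  entire (fill S f).
Proof.
move=> Nc Np w; have [wr|wr] := boolP (w \in r).
  have [g gw Ng] := Np _ wr.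
  apply: cderivable_near; last first.
    by apply: filterS (fill_prodV_on wr (cderivable_cont gw) Ng) => ? ->.
  apply: cderivableM gw; apply: cderivableM; first exact: cderivable_cst.
  by apply/prodV_cderivable; rewrite mem_rem_uniqF.
apply: cderivable_near (fill_prodV_off wr).
apply: cderivableM (Nc w); apply: cderivableM; first exact: cderivable_cst.
exact/prodV_cderivable.
Qed.

End Fill.
End RemovableSingularities.

(** * Scalar products and convergence in a Hilbert space of entire functions *)

Section HilbertSpace.
Local Open Scope ring_scope.
Context {R : realType}.
Local Notation C := R[i].
Variables (H : fspace R) (hH : hilbert_entire H).
Implicit Types (f g h : C -> C) (c w : C) (u : nat -> C -> C).

Lemma gt0_complex (e : C) : 0 < e -> exists2 d : R, 0 < d & e = d%:C.
Proof.
by case: e => a b; rewrite ltcE /= => /andP[/eqP-> a0]; exists a.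
Qed.

(** The same conjugation as in the hypothesis, read as the one of the numeric
hierarchy, whose rewriting rules apply. *)
Lemma fprodC f g : fdom H f -> fdom H g -> fprod H g f = (fprod H f g)^*.
Proof. exact: fprod_conj. Qed.

Lemma fprod0r f : fdom H f -> fprod H f (fun=> 0) = 0.
Proof.
move=> Hf; rewrite -[RHS](mul0r (fprod H f f)) -fprodZr//; congr (fprod _ _ _).
by apply/funext => w; rewrite mul0r.
Qed.

Lemma fprodDl f g h : fdom H f -> fdom H g -> fdom H h ->
  fprod H (f \+ g) h = fprod H f h + fprod H g h.
Proof.
move=> Hf Hg Hh; rewrite (fprodC Hh (domD hH Hf Hg)) fprodDr// rmorphD /=.
by rewrite -!fprodC.
Qed.

Lemma fprodZl c f g : fdom H f -> fdom H g ->
  fprod H (fun w => c * f w) g = c^* * fprod H f g.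
Proof.
move=> Hf Hg; rewrite (fprodC Hg (domZ hH c Hf)) fprodZr// rmorphM /=.
by rewrite -fprodC.
Qed.

Lemma fdomB f g : fdom H f -> fdom H g -> fdom H (f \- g).
Proof.
move=> Hf Hg.
have -> : f \- g = f \+ (fun w => -1 * g w) by apply/funext => w /=; rewrite mulN1r.
exact/domD/domZ.
Qed.

Lemma fprodBl f g h : fdom H f -> fdom H g -> fdom H h ->
  fprod H (f \- g) h = fprod H f h - fprod H g h.
Proof.
move=> Hf Hg Hh.
have -> : f \- g = f \+ (fun w => -1 * g w) by apply/funext => w /=; rewrite mulN1r.
rewrite fprodDl//; last exact: domZ.
by rewrite fprodZl// rmorphN rmorph1 mulN1r.
Qed.

Lemma fprodBr f g h : fdom H f -> fdom H g -> fdom H h ->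
  fprod H f (g \- h) = fprod H f g - fprod H f h.
Proof.
move=> Hf Hg Hh; rewrite (fprodC (fdomB Hg Hh) Hf) fprodBl// rmorphB /=.
by rewrite -!fprodC.
Qed.

Lemma fdom_sum m (F : 'I_m -> C -> C) (c : 'I_m -> C) :
  (forall i, fdom H (F i)) -> fdom H (fun w => \sum_i c i * F i w).
Proof.
elim: m F c => [|m IH] F c HF.
  have -> : (fun w => \sum_(i < 0) c i * F i w) = fun=> 0 :> C.
    by apply/funext => w; rewrite big_ord0.
  exact: dom0.
have -> : (fun w => \sum_i c i * F i w) = (fun w => c ord0 * F ord0 w) \+
    (fun w => \sum_i c (lift ord0 i) * F (lift ord0 i) w).
  by apply/funext => w; rewrite big_ord_recl.
by apply: domD; [|exact: domZ|exact: IH].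
Qed.

Lemma fprod_sumr m (F : 'I_m -> C -> C) (c : 'I_m -> C) f :
  fdom H f -> (forall i, fdom H (F i)) ->
  fprod H f (fun w => \sum_i c i * F i w) = \sum_i c i * fprod H f (F i).
Proof.
move=> Hf; elim: m F c => [|m IH] F c HF.
  rewrite big_ord0 -[RHS](fprod0r Hf); congr (fprod _ _ _).
  by apply/funext => w; rewrite big_ord0.
have -> : (fun w => \sum_i c i * F i w) = (fun w => c ord0 * F ord0 w) \+
    (fun w => \sum_i c (lift ord0 i) * F (lift ord0 i) w).
  by apply/funext => w; rewrite big_ord_recl.
rewrite fprodDr//; [|exact: domZ|exact: fdom_sum].
by rewrite fprodZr// IH// big_ord_recl.
Qed.

Lemma fprod_suml m (F : 'I_m -> C -> C) (c : 'I_m -> C) f :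
  fdom H f -> (forall i, fdom H (F i)) ->
  fprod H (fun w => \sum_i c i * F i w) f = \sum_i (c i)^* * fprod H (F i) f.
Proof.
move=> Hf HF; rewrite (fprodC Hf (fdom_sum c HF)) fprod_sumr// rmorph_sum /=.
by apply: eq_bigr => i _; rewrite rmorphM /= -fprodC.
Qed.

(** Positivity of the square norm of [f - c g] for the optimal [c]. *)
Lemma cauchy_schwarz f g : fdom H f -> fdom H g ->
  `|fprod H f g| ^+ 2 <= fprod H f f * fprod H g g.
Proof.
move=> Hf Hg; rewrite normCK.
have [g0|g0] := eqVneq (fprod H g g) 0.
  by rewrite g0 mulr0 (fprod_eq0 hH Hg g0) fprod0r// mul0r.
(* [c g] is the orthogonal projection of [f] on the line of [g]. *)
pose c := fprod H g f / fprod H g g.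
have gg : (fprod H g g)^* = fprod H g g by rewrite -fprodC.
have cE : c^* = fprod H f g / fprod H g g.
  by rewrite /c rmorphM /= -fprodC// fmorphV /= gg.
have Hcg := domZ hH c Hg.
have := fprod_ge0 hH (fdomB Hf Hcg).
rewrite fprodBl//; last exact: fdomB.
rewrite !fprodBr// !fprodZr// !fprodZl//. rewrite cE /c -fprodC//.
have -> : fprod H f f - c * fprod H f g -
   (fprod H f g / fprod H g g * fprod H g f -
    c * (fprod H f g / fprod H g g * fprod H g g)) =
   fprod H f f - (fprod H f g * fprod H g f) / fprod H g g.
  by rewrite /c; field.
rewrite subr_ge0 ler_pdivrMr//.
by rewrite lt_def g0 fprod_ge0.
Qed.

Lemma fnorm_sqr f : fdom H f -> fprod H f f = (fnorm H f ^+ 2)%:C.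
Proof.
move=> Hf; have := fprod_ge0 hH Hf; rewrite lecE /= => /andP[/eqP im re].
rewrite sqr_sqrtr//; move: im re; case: (fprod H f f) => a b /= -> _ //.
Qed.

Lemma cvg_eval u f w : (forall k, fdom H (u k)) -> fdom H f ->
  fnorm H (u k \- f) @[k --> \oo] --> (0 : R) ->
  (u k w : C^o) @[k --> \oo] --> (f w : C^o).
Proof.
move=> Hu Hf uf; apply/cvgrPdist_lt => e /gt0_complex[d d0 ->].
have [d' d'0 K] := eval_continuous hH w d0.
have ud : \forall k \near \oo, fnorm H (u k \- f) < d'.
  exact: (cvgr_lt _ uf _ d'0).
apply: filterS ud => k /(K _ _ (Hu k) Hf).
by rewrite distrC.
Qed.

Lemma cvg_fprod u f g : (forall k, fdom H (u k)) -> fdom H f -> fdom H g ->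
  fnorm H (u k \- f) @[k --> \oo] --> (0 : R) ->
  (fprod H (u k) g : C^o) @[k --> \oo] --> (fprod H f g : C^o).
Proof.
move=> Hu Hf Hg uf; apply/cvgrPdist_lt => e /gt0_complex[d d0 ->].
(* Adding 1 keeps the divisor positive when [g] is zero. *)
pose b := fnorm H g + 1.
have b0 : 0 < b by rewrite ltr_wpDl// sqrtr_ge0.
have ub : \forall k \near \oo, fnorm H (u k \- f) < d / b.
  exact: (cvgr_lt _ uf _ (divr_gt0 d0 b0)).
apply: filterS ub => k ub.
rewrite -fprodBl//.
have n0 (h : C -> C) : 0 <= fnorm H h by rewrite sqrtr_ge0.
have -> : fprod H (f \- u k) g = - fprod H (u k \- f) g.
  by rewrite !fprodBl// opprB.
rewrite normrN.
have d0' : 0 <= d%:C by rewrite ler0c ltW.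
rewrite -(@ltr_pXn2r _ 2)// ?nnegrE//.
apply: le_lt_trans (cauchy_schwarz (fdomB (Hu k) Hf) Hg) _.
rewrite !fnorm_sqr//; last exact: fdomB.
rewrite -rmorphM -rmorphXn /= ltcR -exprMn.
have fg0 : 0 <= fnorm H (u k \- f) * fnorm H g by rewrite mulr_ge0.
rewrite ltr_pXn2r ?nnegrE ?(ltW d0)//.
have : fnorm H (u k \- f) * b < d by rewrite -ltr_pdivlMr.
apply: le_lt_trans; rewrite ler_wpM2l//.
by rewrite /b lerDl.
Qed.

Lemma cvg_shift_harmonic (z : C) :
  (z + (k.+1%:R^-1)%:C : C^o) @[k --> \oo] --> (z : C^o).
Proof.
apply/cvgrPdist_lt => e /gt0_complex[d d0 ->].
have h : \forall k \near \oo, (k.+1%:R^-1 : R) < d.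
  exact: (cvgr_lt _ (@cvg_harmonic R) _ d0).
apply: filterS h => k kd.
rewrite opprD addNKr normrN normc_def /= expr0n addr0 sqrtr_sqr ltcR ger0_norm//.
Qed.

End HilbertSpace.

(** * Interpolation *)

Section LinearAlgebra.
Local Open Scope ring_scope.
Variable F : fieldType.

(** The two sides have size at most [m] and agree at [m] distinct points. *)
Lemma lagrange_interpolation m (u : 'I_m -> F) (P : {poly F}) :
  injective u -> (size P <= m)%N ->
  P = \sum_i (P.[u i] / \prod_(j | j != i) (u i - u j)) *:
        \prod_(j | j != i) ('X - (u j)%:P).
Proof.
move=> u_inj szP; apply/eqP; rewrite -subr_eq0; apply/eqP.
set Q := \sum_i _.
have szQ : (size Q <= m)%N.
  apply: leq_trans (size_sum _ _ _) _; apply/bigmax_leqP => i _.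
  apply: leq_trans (size_scale_leq _ _) _.
  rewrite (leq_trans (size_poly_prod_leq _ _))//.
  rewrite (eq_bigr (fun=> 2%N)) => [|j _]; last by rewrite size_XsubC.
  rewrite sum_nat_const cardC1 card_ord; have := ltn_ord i; lia.
apply: (@roots_geq_poly_eq0 _ _ [seq u i | i <- enum 'I_m]).
- apply/allP => _ /mapP[i _ ->]; rewrite /root hornerD hornerN subr_eq0 eq_sym.
  rewrite /Q horner_sum (bigD1 i)//= [X in _ + X]big1 ?addr0.
    rewrite hornerZ horner_prod.
    under [X in _ * X]eq_bigr do rewrite !hornerE.
    rewrite divfK//; apply/prodf_neq0 => j ji.
    by rewrite subr_eq0 (inj_eq u_inj) eq_sym.
  move=> k ki; rewrite hornerZ horner_prod [X in _ * X](bigD1 i) 1?eq_sym//= !hornerE.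
  by rewrite subrr /= mulr0 mul0r.
- by rewrite map_inj_uniq ?enum_uniq.
rewrite size_map size_enum_ord.
by apply: leq_trans (size_polyD _ _) _; rewrite size_polyN geq_max szP.
Qed.

(** In the plane the vectors orthogonal to a given nonzero vector form a line;
the nonvanishing coordinates are those available at the points of sigma. *)
Lemma plane_proportional (x y a b c d : F) : x != 0 -> d != 0 ->
  a * x + b * y = 0 -> c * x + d * y = 0 ->
  exists k, a = k * c /\ b = k * d.
Proof.
move=> x0 d0 e1 e2; exists (b / d); rewrite divfK//; split=> //.
apply: (mulIf x0).
have -> : a * x = - (b * y) by apply/eqP; rewrite -addr_eq0 e1.
have -> : b / d * c * x = b / d * (c * x) by rewrite mulrA.
have -> : c * x = - (d * y) by apply/eqP; rewrite -addr_eq0 e2.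
by field.
Qed.

End LinearAlgebra.

(** * The kernel attached to a pair of entire functions *)

Section Kernel.
Local Open Scope ring_scope.
Context {R : realType}.
Local Notation C := R[i].
Implicit Types (A B : C -> C) (z w : C).

(** Numerator of the kernel, without the factor 2. *)
Definition dbnum A B z w : C := (B z)^* * A w - (A z)^* * B w.

(** Reduces every assertion on the transform of [B] to one on the transform of
the first function of a pair. *)
Lemma dbkernel_swap A B : dbkernel B (fun w => - A w) = dbkernel A B.
Proof.
apply/funext => z; rewrite /dbkernel; congr (fill _ _); apply/funext => w.
by rewrite rmorphN /=; congr (2 * _ / _); rewrite mulNr mulrN opprK addrC.
Qed.

Lemma dbkernel_off A B z w : w != z^* ->
  dbkernel A B z w = 2 * dbnum A B z w / (z^* - w).
Proof. by move=> wz; rewrite /dbkernel /fill /= ifN. Qed.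

Lemma dbnum_cderivable A B z : entire A -> entire B ->
  forall w, cderivable (dbnum A B z) w.
Proof.
move=> Ae Be w.
have h := cderivableD (cderivableM (@cderivable_cst _ (B z)^* w) (Ae w))
  (cderivableM (@cderivable_cst _ (- (A z)^*) w) (Be w)).
have -> : dbnum A B z = (fun w' => (B z)^* * A w' + - (A z)^* * B w').
  by apply/funext => v; rewrite mulNr.
exact: h.
Qed.

(** Near [z^*] the numerator is a vanishing factor times the continuous
kernel. *)
Lemma dbnum_diag A B z : entire A -> entire B ->
  cont_at (dbkernel A B z) z^* -> dbnum A B z z^* = 0.
Proof.
move=> Ae Be Kc.
pose g w := (z^* - w) * dbkernel A B z w / 2.
have gc : cont_at g z^*.
  apply: cont_atM; last exact: cont_at_cst.
  apply: cont_atM Kc; apply: cont_atB; first exact: cont_at_cst.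
  exact: (cderivable_cont (@cderivable_id _ _)).
have nc := cderivable_cont (@dbnum_cderivable A B z Ae Be z^*).
rewrite (eq_punctured nc gc) ?/g ?subrr ?mul0r//.
apply/dnearcP; exists 1 => // w wz _; rewrite dbkernel_off//.
have : z^* - w != 0 by rewrite subr_eq0 eq_sym.
by move=> zw; field.
Qed.

Lemma dbkernelE A B z w : dbnum A B z z^* = 0 ->
  (z^* - w) * dbkernel A B z w = 2 * dbnum A B z w.
Proof.
move=> d0; have [->|wz] := eqVneq w z^*; first by rewrite subrr mul0r d0 mulr0.
by rewrite dbkernel_off// mulrC divfK// subr_eq0 eq_sym.
Qed.

(** At [z^*] the kernel is, up to a factor, the difference quotient of its
numerator, which vanishes there. *)
Lemma dbkernel_cont A B z : entire A -> entire B ->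
  dbnum A B z z^* = 0 -> forall w, cont_at (dbkernel A B z) w.
Proof.
move=> Ae Be d0 w.
have nd := @dbnum_cderivable A B z Ae Be.
have [->|wz] := eqVneq w z^*.
  have [q qc qE] := cderivable_quot (nd z^*).
  have q2 : cont_at (fun w => - 2 * q w) z^*.
    by apply: cont_atM qc; exact: cont_at_cst.
  apply: (cont_at_near q2).
  have K := @fill_near _ (pred1 z^*) (fun w => 2 * dbnum A B z w / (z^* - w))
    (fun w => - 2 * q w) z^*.
  have := K (eqxx _) q2 _; move=> h.
  apply: filterS (h _) => [w' <- //|].
  apply/dnearcP; exists 1 => // w' wz _; split=> //.
  rewrite qE d0 add0r.
  have : z^* - w' != 0 by rewrite subr_eq0 eq_sym.
  by move=> zw; field.
apply: (@cont_at_near _ (fun w' => 2 * dbnum A B z w' * (z^* - w')^-1)).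
  apply: cont_atM.
    by apply: cont_atM (cderivable_cont (nd w)); exact: cont_at_cst.
  apply: cderivable_cont; apply: cderivableV; first by rewrite subr_eq0 eq_sym.
  have h := cderivableD (@cderivable_cst _ z^* w)
    (cderivableM (@cderivable_cst _ (-1) w) (@cderivable_id _ w)).
  apply: cderivable_near h _; apply/nearcP; exists 1 => // w' _ /=.
  by rewrite mulN1r.
by apply: filterS (near_neq wz) => w' wz'; rewrite dbkernel_off.
Qed.

End Kernel.

(** * The functions replacing the derivatives in x *)

Section Chain.
Local Open Scope ring_scope.
Variable F : comNzRingType.
Implicit Types (A B : F -> F) (w : F).

(** Coefficients of [A] and [B] in the [j]-th term of the chain: the real and
imaginary parts of [(- 'i) ^+ j]. *)
Fixpoint chain (j : nat) : F * F :=
  if j is j'.+1 then ((chain j').2, - (chain j').1) else (1, 0).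

(** The [j]-th derivative of [A] with respect to the parameter in the case
[mu = 0]. *)
Definition echain A B j w : F :=
  w ^+ j * ((chain j).1 * A w + (chain j).2 * B w).

Lemma chain_sqr j : (chain j).1 ^+ 2 + (chain j).2 ^+ 2 = 1.
Proof. by elim: j => [|j IH] /=; [rewrite expr1n expr0n addr0|rewrite sqrrN addrC]. Qed.

(** Even terms of the chain involve [A] only and odd terms [B] only; the sign
identities express this uniformly in [j]. *)
Lemma chain_sign j :
  (-1) ^+ j * (chain j).1 = (chain j).1 /\ (-1) ^+ j * (chain j).2 = - (chain j).2.
Proof.
elim: j => [|j [IH1 IH2]] /=; first by rewrite !mul1r oppr0.
by rewrite !exprS !mulN1r !mulNr mulrN IH1 IH2 !opprK.
Qed.

(** The parity of the power of [w] compensates the change from [A] to [B]. *)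
Lemma echain_opp A B (eps : F) j w :
  (forall w, A (- w) = eps * A w) -> (forall w, B (- w) = - (eps * B w)) ->
  echain A B j (- w) = eps * echain A B j w.
Proof.
move=> Ao Bo; rewrite /echain Ao Bo exprNn.
have [h1 h2] := chain_sign j.
transitivity (eps * (w ^+ j * ((-1) ^+ j * (chain j).1 * A w - (-1) ^+ j * (chain j).2 * B w))).
  by ring.
by rewrite h1 h2 mulNr opprK.
Qed.

Definition chain_poly1 m (c : nat -> F) : {poly F} := \poly_(j < m) (c j * (chain j).1).
Definition chain_poly2 m (c : nat -> F) : {poly F} := \poly_(j < m) (c j * (chain j).2).

Lemma sum_echain m (c : nat -> F) A B w : \sum_(j < m) c j * echain A B j w =
  (chain_poly1 m c).[w] * A w + (chain_poly2 m c).[w] * B w.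
Proof.
rewrite !horner_poly !mulr_suml -big_split /=; apply: eq_bigr => j _.
by rewrite /echain; ring.
Qed.

Lemma chain_poly_eq0 m c : chain_poly1 m c = 0 -> chain_poly2 m c = 0 ->
  forall j, (j < m)%N -> c j = 0.
Proof.
move=> /polyP P0 /polyP Q0 j jm.
have := P0 j; have := Q0 j; rewrite !coef_poly !coef0 jm => q p.
by rewrite -[c j]mulr1 -(chain_sqr j) mulrDr !expr2 !mulrA p q !mul0r addr0.
Qed.

(** The coefficients of degree [n] contribute the sum of squares of
[chain_sqr] to the coefficient of degree [2 n], which is therefore 1. *)
Lemma chain_poly_monic n c d : c n = 1 -> d n = 1 ->
  chain_poly1 n.+1 c * chain_poly1 n.+1 d + chain_poly2 n.+1 c * chain_poly2 n.+1 d
   \is monic /\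
  size (chain_poly1 n.+1 c * chain_poly1 n.+1 d
          + chain_poly2 n.+1 c * chain_poly2 n.+1 d) = n.*2.+1.
Proof.
move=> cn dn.
set P := chain_poly1 _ c * _ + _.
have szl (p q : {poly F}) : (size p <= n.+1)%N -> (size q <= n.+1)%N ->
    (size (p * q)%R <= n.*2.+1)%N.
  move=> sp sq; apply: leq_trans (size_polyMleq _ _) _; lia.
have szP : (size P <= n.*2.+1)%N.
  apply: leq_trans (size_polyD _ _) _.
  by rewrite geq_max !szl ?size_poly.
have top (p q : {poly F}) : (size p <= n.+1)%N -> (size q <= n.+1)%N ->
    (p * q)`_(n.*2) = p`_n * q`_n.
  move=> sp sq; rewrite coefM.
  have nn : (n < n.*2.+1)%N by lia.
  rewrite (bigD1 (Ordinal nn))//= big1 ?addr0.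
    by congr (_ * q`_ _); lia.
  move=> [i ilt]; rewrite -val_eqE /= => iN.
  have [ni|ni] := ltnP n i; first by rewrite (nth_default _ (leq_trans sp ni)) mul0r.
  by rewrite (nth_default _ (leq_trans sq _)) ?mulr0//; lia.
have Pn : P`_(n.*2) = 1.
  rewrite coefD !top ?size_poly// !coef_poly ltnSn cn dn !mul1r.
  by rewrite -!expr2 chain_sqr.
have sP : size P = n.*2.+1.
  apply/eqP; rewrite eqn_leq szP ltnNge; apply/negP => h.
  by move: Pn => /eqP; rewrite nth_default// eq_sym oner_eq0.
by split=> //; rewrite monicE lead_coefE sP Pn.
Qed.

End Chain.

(** * Spaces whose evaluators are given by a pair of entire functions *)

Section KernelSpace.
Local Open Scope ring_scope.
Context {R : realType}.
Local Notation C := R[i].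

(** What the hypotheses say about one value of the parameter. *)
Record kernel_space (H : fspace R) (A B : C -> C) : Prop := KernelSpace {
  ks_hilbert : hilbert_entire H;
  ks_entire1 : entire A;
  ks_entire2 : entire B;
  ks_eval : evaluators H (dbkernel A B) }.

Lemma kernel_space_swap H A B :
  kernel_space H A B -> kernel_space H B (fun w => - A w).
Proof.
case=> hH Ae Be Ze; split; [exact: hH|exact: Be|move=> w|by rewrite dbkernel_swap].
have h := cderivableM (@cderivable_cst _ (-1) w) (Ae w).
apply: cderivable_near h _; apply/nearcP; exists 1 => // w' _.
by rewrite mulN1r.
Qed.

Variables (H : fspace R) (A B : C -> C) (D : kernel_space H A B).
Local Notation Z := (dbkernel A B).
Implicit Types (z w p : C).

Lemma dbkernel_dom z : fdom H (Z z). Proof. exact: (ks_eval D).1. Qed.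

Lemma dbkernel_entire z : entire (Z z). Proof. exact: (dom_entire (ks_hilbert D) (dbkernel_dom z)). Qed.

(** A consequence of the evaluator at [z] being an entire function; it plays the
part of the reality of [A] and [B] away from the real line. *)
Lemma dbnum_conj_eq0 z : dbnum A B z z^* = 0.
Proof.
have [_ Ae Be _] := D; apply: dbnum_diag => //.
exact: (cderivable_cont (@dbkernel_entire z z^*)).
Qed.

Lemma dbkernel_mulE z w : (z^* - w) * Z z w = 2 * dbnum A B z w.
Proof. exact/dbkernelE/dbnum_conj_eq0. Qed.

Lemma dbnum_reflection w : (B w^*)^* * A w + - (A w^*)^* * B w = 0.
Proof. by have := dbnum_conj_eq0 w^*; rewrite conjCK /dbnum mulNr. Qed.

(** Subtracting the values of [P] and [Q] at [p] leaves terms divisible by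
[w - p] and the combination [P.[p] A + Q.[p] B].  The latter vanishes at [p],
so it is a multiple of the numerator of the evaluator at [p^*], and its
quotient by [w - p] is this evaluator, an entire function. *)
Lemma linear_combination_quotient (P Q : {poly C}) p : A p != 0 -> A p^* != 0 ->
  P.[p] * A p + Q.[p] * B p = 0 ->
  exists2 g, entire g & forall w, P.[w] * A w + Q.[w] * B w = (w - p) * g w.
Proof.
move=> A0 A0' PQ0.
have dA : - (A p^*)^* != 0 by rewrite oppr_eq0 conjC_eq0.
have [k [kP kQ]] := plane_proportional A0 dA PQ0 (dbnum_reflection p).
have [P' PE] : exists P', P = P' * ('X - p%:P) + P.[p]%:P.
  have /factor_theorem[P' PE] : root (P - P.[p]%:P) p.
    by rewrite /root !hornerE subrr.
  by exists P'; rewrite -PE subrK.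
have [Q' QE] : exists Q', Q = Q' * ('X - p%:P) + Q.[p]%:P.
  have /factor_theorem[Q' QE] : root (Q - Q.[p]%:P) p.
    by rewrite /root !hornerE subrr.
  by exists Q'; rewrite -QE subrK.
exists (fun w => P'.[w] * A w + Q'.[w] * B w + (- k / 2) * Z p^* w).
  move=> w.
  have h := (cderivableD (cderivableD
    (cderivableM (@cderivable_horner _ P' w) (@ks_entire1 _ _ _ D w))
    (cderivableM (@cderivable_horner _ Q' w) (@ks_entire2 _ _ _ D w)))
    (cderivableM (@cderivable_cst _ (- k / 2) w) (@dbkernel_entire p^* w))). exact: h.
move=> w; have := dbkernel_mulE p^* w; rewrite conjCK /dbnum => Zp.
have -> : P.[w] = P'.[w] * (w - p) + P.[p] by rewrite {1}PE !hornerE.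
have -> : Q.[w] = Q'.[w] * (w - p) + Q.[p] by rewrite {1}QE !hornerE.
have -> : (w - p) * (P'.[w] * A w + Q'.[w] * B w + - k / 2 * Z p^* w)
 = (w - p) * (P'.[w] * A w + Q'.[w] * B w) + k / 2 * ((p - w) * Z p^* w) by ring.
by rewrite Zp kP kQ; field.
Qed.

(** Partial fractions of [P A + Q B] over the nodal polynomial of the points
[(u j)^*], cleared of denominators.  The hypotheses on the values of [P] and [Q]
make each Lagrange term a multiple of the numerator of an evaluator. *)
Lemma partial_fractions m (u : 'I_m -> C) (k : 'I_m -> C) (P Q : {poly C}) :
  injective u -> (size P <= m)%N -> (size Q <= m)%N ->
  (forall i, P.[(u i)^*] = k i * (B (u i))^*) ->
  (forall i, Q.[(u i)^*] = k i * - (A (u i))^*) ->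
  forall w, P.[w] * A w + Q.[w] * B w =
    \prod_j (w - (u j)^*) *
    \sum_i (- (k i / \prod_(j | j != i) ((u i)^* - (u j)^*)) / 2) * Z (u i) w.
Proof.
move=> u_inj sP sQ kP kQ w.
have uc_inj : injective (fun i => (u i)^*).
  by move=> i j /(congr1 (fun z => z^*)); rewrite !conjCK => /u_inj.
rewrite {1}(lagrange_interpolation uc_inj sP) {1}(lagrange_interpolation uc_inj sQ).
rewrite !horner_sum !mulr_suml -big_split /= mulr_sumr; apply: eq_bigr => i _.
rewrite !hornerZ !horner_prod kP kQ.
have -> : \prod_(j | j != i) ('X - ((u j)^*)%:P).[w] = \prod_(j | j != i) (w - (u j)^*).
  by apply: eq_bigr => j _; rewrite hornerXsubC.
rewrite [X in _ = X * _](bigD1 i)//=.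
set d := \prod_(j | j != i) _; set D1 := \prod_(j | j != i) _.
have d0 : d != 0.
  apply/prodf_neq0 => j ji; rewrite subr_eq0; apply: contraNneq ji => e.
  by rewrite (uc_inj _ _ (esym e)).
have := dbkernel_mulE (u i) w; rewrite /dbnum => Zp.
transitivity (D1 * (k i / d) / 2 * (2 * ((B (u i))^* * A w - (A (u i))^* * B w))).
  by field.
by rewrite -Zp; ring.
Qed.

End KernelSpace.

(** * Evaluators at the points of sigma *)

Section Sigma.
Local Open Scope ring_scope.
Context {R : realType}.
Local Notation C := R[i].

Record admissible n (s : 'I_n -> C) : Prop := Admissible {
  adm_imag : forall i, (s i)^* = - s i;
  adm_inj : injective s;
  adm_opp : forall i j, s i != - s j }.

(** [eps] is 1 for an even function followed by an odd one, and -1 for the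
swapped pair. *)
Definition parity (eps : C) (A B : C -> C) : Prop :=
  [/\ eps != 0, forall w, A (- w) = eps * A w & forall w, B (- w) = - (eps * B w)].

Definition extend n (f : 'I_n -> C) (j : nat) : C :=
  if insub j is Some i then f i else 0.

Lemma extendE n (f : 'I_n -> C) (i : 'I_n) : extend f i = f i.
Proof. by rewrite /extend valK. Qed.

Variables (H : fspace R) (A B : C -> C) (D : kernel_space H A B).
Variables (n : nat) (s : 'I_n -> C) (sP : admissible s).
Hypothesis indep : linearly_independent (fun i => dbkernel A B (s i)).
Variables (eps : C) (par : parity eps A B).
Local Notation Z := (dbkernel A B).
Local Notation e := (echain A B).
Implicit Types (z w p : C) (P Q : {poly C}).

(** The Gram matrix of independent evaluators is invertible: a combination of
them which vanishes at their points is orthogonal to itself. *)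
Lemma span_eq0 (a : 'I_n -> C) :
  (forall m, \sum_i a i * Z (s i) (s m) = 0) -> forall i, a i = 0.
Proof.
move=> a0; apply: indep.
have Zd i := dbkernel_dom D (s i).
have hH := ks_hilbert D.
pose g w := \sum_i a i * Z (s i) w.
have g_dom : fdom H g by apply: fdom_sum.
suff g0 : g = fun=> 0 by move=> w; rewrite -[LHS]/(g w) g0.
apply: (fprod_eq0 hH g_dom); rewrite {1}/g fprod_suml// big1// => i _.
by rewrite -(ks_eval D).2// [g _]a0 mulr0.
Qed.

Lemma dbkernel_sigma_neq0 i : Z (s i) (s i) != 0.
Proof.
apply/eqP => Z0.
have hH := ks_hilbert D.
have Z00 : Z (s i) = fun=> 0.
  apply: (fprod_eq0 hH (dbkernel_dom D _)).
  by rewrite -(ks_eval D).2//; exact: dbkernel_dom.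
have /(_ _ i) := @indep (fun j => (j == i)%:R).
rewrite eqxx => /(_ _)/eqP; rewrite oner_eq0 => h; apply/notF/h => w.
by apply: big1 => j _; case: eqVneq => [->|_]; rewrite ?Z00 ?mulr0 ?mul0r.
Qed.

(** If [A] or [B] vanished at [s i], the evaluator at [s i] would vanish at its
own point, so its norm would be zero. *)
Lemma sigma_neq0 i : A (s i) != 0 /\ B (s i) != 0.
Proof.
have := dbkernel_mulE D (s i) (s i); rewrite (adm_imag sP) /dbnum => Zi.
have s0 : - s i - s i != 0.
  by rewrite -opprD oppr_eq0 addr_eq0 (adm_opp sP).
have h := mulf_neq0 s0 (dbkernel_sigma_neq0 i); rewrite Zi in h.
by split; apply: contraNneq h => ->; rewrite conjC0 !(mulr0, mul0r) subrr mulr0.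
Qed.

Lemma sigma_opp_neq0 i : A (- s i) != 0.
Proof. by have [e0 -> _] := par; rewrite mulf_neq0// (sigma_neq0 i).1. Qed.

Lemma echain_parity j w : e j (- w) = eps * e j w.
Proof. by have [_ Ao Bo] := par; exact: echain_opp. Qed.

(** The vector of values of [P] and [Q] and the one defining the evaluator at
[s i] are both orthogonal to the nonzero vector of values of [A] and [B] at
[- s i]. *)
Lemma kernel_vector P Q i : P.[- s i] * A (- s i) + Q.[- s i] * B (- s i) = 0 ->
  exists k, P.[(s i)^*] = k * (B (s i))^* /\ Q.[(s i)^*] = k * - (A (s i))^*.
Proof.
rewrite (adm_imag sP) => PQ0.
have dA : - (A (s i))^* != 0 by rewrite oppr_eq0 conjC_eq0 (sigma_neq0 i).1.
have := dbnum_reflection D (- s i); rewrite -(adm_imag sP i) conjCK (adm_imag sP i) => z0.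
exact: plane_proportional (sigma_opp_neq0 i) dA PQ0 z0.
Qed.

Definition echain_mx : 'M[C]_n := \matrix_(j, m) e j (s m).

(** A linear relation between the rows gives a function [P A + Q B] with [P] and
[Q] of degree less than [n], vanishing at all [s i] and [- s i].  The zeros
[- s i] make it a combination of evaluators times a nodal polynomial, and the
zeros [s i] make this combination zero. *)
Lemma det_echain_mx : \det echain_mx != 0.
Proof.
apply/det0P => -[v v0 vE].
pose c := extend (v 0).
have cE w : \sum_(j < n) v 0 j * e j w =
    (chain_poly1 n c).[w] * A w + (chain_poly2 n c).[w] * B w.
  by rewrite -sum_echain; apply: eq_bigr => j _; rewrite /c extendE.
set P := chain_poly1 n c in cE; set Q := chain_poly2 n c in cE.
have Ns m : \sum_(j < n) v 0 j * e j (s m) = 0.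
  move/rowP: vE => /(_ m); rewrite !mxE => h.
  by rewrite -[RHS]h; apply: eq_bigr => j _; rewrite ?mxE.
have NNs m : \sum_(j < n) v 0 j * e j (- s m) = 0.
  transitivity (eps * \sum_(j < n) v 0 j * e j (s m)); last by rewrite Ns mulr0.
  by rewrite mulr_sumr; apply: eq_bigr => j _; rewrite echain_parity mulrCA.
have /choice[k kP] : forall i, exists k,
    P.[(s i)^*] = k * (B (s i))^* /\ Q.[(s i)^*] = k * - (A (s i))^*.
  by move=> i; apply: kernel_vector; rewrite -cE.
have szP : (size P <= n)%N by exact: size_poly.
have szQ : (size Q <= n)%N by exact: size_poly.
have PF := partial_fractions D (adm_inj sP) szP szQ
  (fun i => (kP i).1) (fun i => (kP i).2).
pose a i := - (k i / \prod_(j | j != i) ((s i)^* - (s j)^*)) / 2.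
have a0 : forall i, a i = 0.
  apply: span_eq0 => m.
  have := PF (s m); rewrite -cE Ns => /esym/eqP; rewrite mulf_eq0 => /orP[|/eqP//].
  rewrite prodf_seq_eq0 => /hasP[j _] /=.
  by rewrite (adm_imag sP) opprK addr_eq0 (negbTE (adm_opp sP _ _)).
have k0 i : k i = 0.
  have /eqP := a0 i; rewrite /a mulf_eq0 invr_eq0 pnatr_eq0 orbF oppr_eq0.
  rewrite mulf_eq0 invr_eq0 => /orP[/eqP//|].
  rewrite prodf_seq_eq0 => /hasP[j _] /andP[ji].
  by rewrite subr_eq0 (inj_eq (can_inj (@conjCK _))) (inj_eq (adm_inj sP)) eq_sym (negbTE ji).
have sc_inj : injective (fun i => (s i)^*).
  by move=> i j /(can_inj (@conjCK _)) /(adm_inj sP).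
have P0 : P = 0.
  rewrite (lagrange_interpolation sc_inj szP) big1// => i _.
  by rewrite (kP i).1 k0 !mul0r scale0r.
have Q0 : Q = 0.
  rewrite (lagrange_interpolation sc_inj szQ) big1// => i _.
  by rewrite (kP i).2 k0 !mul0r scale0r.
case/eqP: v0; apply/rowP => j; rewrite mxE.
by have := chain_poly_eq0 P0 Q0 (ltn_ord j); rewrite /c extendE.
Qed.

End Sigma.

(** * The ratio of determinants *)

Section Ratio.
Local Open Scope ring_scope.
Context {R : realType}.
Local Notation C := R[i].
Variables (H : fspace R) (A B : C -> C) (D : kernel_space H A B).
Variables (n : nat) (s : 'I_n -> C) (sP : admissible s).
Hypothesis indep : linearly_independent (fun i => dbkernel A B (s i)).
Variables (eps : C) (par : parity eps A B).
Local Notation Z := (dbkernel A B).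
Local Notation e := (echain A B).
Implicit Types (z w p : C) (P Q : {poly C}).

Definition echain_mx_append w : 'M[C]_n.+1 := \matrix_(j, m) e j (append s w m).

Lemma append_max w : append s w ord_max = w.
Proof. by rewrite /append unlift_none. Qed.

Lemma append_lift w i : append s w (lift ord_max i) = s i.
Proof. by rewrite /append liftK. Qed.

Lemma chain_conj k : (chain C k).1^* = (chain C k).1 /\ (chain C k).2^* = (chain C k).2.
Proof.
elim: k => [|k [IH1 IH2]] /=; first by rewrite conjC1 conjC0.
by rewrite IH2 rmorphN /= IH1.
Qed.

(** Conjugation at [s i] multiplies the whole column of values by one factor, so
it does not affect ratios of determinants. *)
Lemma conj_echain i : exists2 l, l != 0 & forall j, (e j (s i))^* = l * e j (s i).
Proof.
have [eps0 _ _] := par.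
have A0 := (sigma_neq0 D sP indep i).1; have AN0 := sigma_opp_neq0 D sP indep par i.
exists ((A (s i))^* / A (- s i) * eps).
  by rewrite !mulf_neq0// ?conjC_eq0 ?invr_eq0.
move=> j; rewrite -!mulrA -(echain_parity par) /echain rmorphM rmorphXn rmorphD !rmorphM /=.
rewrite !(chain_conj _).1 !(chain_conj _).2 (adm_imag sP).
have := dbnum_conj_eq0 D (s i); rewrite /dbnum (adm_imag sP) => /eqP; rewrite subr_eq0 => /eqP h.
have -> : (B (s i))^* = (A (s i))^* * B (- s i) / A (- s i) by rewrite -h; field.
by field.
Qed.

(** Expansion along the last column gives the coefficients.  The leading one is
1 since its cofactor is the denominator.  They are real because the vanishing
at the [s i] determines them and is stable under conjugation. *)
Lemma det_echain_ratio : exists c : nat -> C,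
  [/\ c n = 1, forall j, (c j)^* = c j,
      forall w, \det (echain_mx_append w) / \det (echain_mx A B s) =
        \sum_(j < n.+1) c j * e j w
    & forall i, \sum_(j < n.+1) c j * e j (s i) = 0].
Proof.
have E0 := det_echain_mx D sP indep par.
pose c := extend (fun j : 'I_n.+1 =>
   cofactor (echain_mx_append 0) j ord_max / \det (echain_mx A B s)).
have cE w : \det (echain_mx_append w) / \det (echain_mx A B s) =
    \sum_(j < n.+1) c j * e j w.
  rewrite (expand_det_col _ ord_max) mulr_suml; apply: eq_bigr => j _.
  rewrite /c extendE mxE append_max [_ * cofactor _ _ _]mulrC mulrAC; congr (_ / _ * _).
  rewrite /cofactor; congr (_ * \det _); apply/matrixP => a b.
  by rewrite !mxE !append_lift.
have cn : c n = 1.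
  have -> : c n = c (@ord_max n) by [].
  rewrite /c extendE /cofactor addnn -signr_odd odd_double mul1r.
  have -> : row' ord_max (col' ord_max (echain_mx_append 0)) = echain_mx A B s.
    by apply/matrixP => a b; rewrite !mxE append_lift lift_max.
  by rewrite divff.
have c0 i : \sum_(j < n.+1) c j * e j (s i) = 0.
  rewrite -cE -det_tr (@determinant_alternate _ _ _ (lift ord_max i) ord_max) ?mul0r//.
    by rewrite eq_sym neq_lift.
  by move=> j; rewrite !mxE append_max append_lift.
exists c; split=> // j.
have [jn|jn] := ltnP j n; last first.
  have [->|jn'] := eqVneq j n; first by rewrite cn conjC1.
  rewrite /c /extend insubF ?conjC0//; apply/negbTE; rewrite -leqNgt.
  by rewrite ltn_neqAle eq_sym jn'.
pose v : 'rV[C]_n := \row_(j < n) (c j - (c j)^*).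
suff : v = 0.
  by move/rowP/(_ (Ordinal jn))/eqP; rewrite !mxE subr_eq0 => /eqP.
apply/eqP; apply/contraT => v0; case/negP: E0; apply/det0P; exists v => //.
apply/rowP => m; rewrite !mxE.
have [l l0 lE] := conj_echain m.
have h1 := c0 m; have h2 : \sum_(j < n.+1) (c j)^* * e j (s m) = 0.
  apply: (mulfI l0); rewrite mulr0 mulr_sumr -[RHS]conjC0 -[in RHS](c0 m) rmorph_sum /=.
  by apply: eq_bigr => k _; rewrite rmorphM /= lE mulrCA.
have : \sum_(j < n.+1) (c j - (c j)^*) * e j (s m) = 0.
  transitivity (\sum_(j < n.+1) c j * e j (s m) - \sum_(j < n.+1) (c j)^* * e j (s m)).
    by rewrite -sumrB; apply: eq_bigr => k _; rewrite mulrBl.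
  by rewrite h1 h2 subrr.
rewrite big_ord_recr /= cn conjC1 subrr mul0r addr0 => h; rewrite -[RHS]h.
by apply: eq_bigr => k _; rewrite !mxE.
Qed.

End Ratio.

(** * The points of sigma and their opposites *)

Section PolesOfGamma.
Local Open Scope ring_scope.
Context {R : realType}.
Local Notation C := R[i].
Variables (n : nat) (s : 'I_n -> C) (sP : admissible s).
Implicit Types (z w : C).

Definition sigma_pm : seq C :=
  [seq s i | i <- enum 'I_n] ++ [seq - s i | i <- enum 'I_n].

Lemma sigma_pmP w : reflect (exists i, w = s i \/ w = - s i) (w \in sigma_pm).
Proof.
rewrite mem_cat; apply: (iffP orP).
  by case=> /mapP[i _ ->]; exists i; [left|right].
by case=> i [->|->]; [left|right]; apply: map_f; rewrite mem_enum.
Qed.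

Lemma sigma_pm_uniq : uniq sigma_pm.
Proof.
have ninj : injective (fun i => - s i) by move=> i j /oppr_inj /(adm_inj sP).
rewrite cat_uniq (map_inj_uniq (adm_inj sP)) (map_inj_uniq ninj) enum_uniq andbT /=.
apply/hasPn => _ /mapP[i _ ->]; apply/mapP => -[j _ /eqP].
by rewrite eq_sym (negbTE (adm_opp sP _ _)).
Qed.

Lemma sigma_pm_opp w : (- w \in sigma_pm) = (w \in sigma_pm).
Proof.
apply/sigma_pmP/sigma_pmP => -[i [e|e]]; exists i.
- by right; rewrite -e opprK.
- by left; apply: oppr_inj.
- by right; rewrite e.
by left; rewrite e opprK.
Qed.

Lemma sigma_pm_conj w : (w^* \in sigma_pm) = (w \in sigma_pm).
Proof.
have c i := adm_imag sP i.
have c' i : (- s i)^* = s i by rewrite rmorphN /= c opprK.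
apply/sigma_pmP/sigma_pmP => -[i [e|e]]; exists i.
- by right; rewrite -[w]conjCK e c.
- by left; rewrite -[w]conjCK e c'.
- by right; rewrite e c.
by left; rewrite e c'.
Qed.

Lemma on_sigma_pm w : (on_sigma s w || on_sigma s (- w)) = (w \in sigma_pm).
Proof.
apply/orP/sigma_pmP => [[/existsP[i /eqP e]|/existsP[i /eqP e]]|[i [e|e]]].
- by exists i; left.
- by exists i; right; rewrite -e opprK.
- by left; apply/existsP; exists i; rewrite e.
by right; apply/existsP; exists i; rewrite e opprK.
Qed.

(** The points of sigma and their opposites are paired in products. *)
Lemma big_sigma_pm (F : C -> C) :
  \prod_(a <- sigma_pm) F a = \prod_(i < n) (F (s i) * F (- s i)).
Proof. by rewrite big_cat !big_map big_split -!big_enum. Qed.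

Definition gamgam w := gam s w * gam s (- w).

Lemma gamgamE w : gamgam w = (-1) ^+ n * \prod_(a <- sigma_pm) (w - a)^-1.
Proof.
have -> : (-1) ^+ n = \prod_(i < n) (-1 : C) by rewrite prodr_const card_ord.
rewrite big_sigma_pm /gamgam /gam -!big_split /=.
apply: eq_bigr => i _.
by rewrite opprK -opprD invrN mulN1r mulrN.
Qed.

Lemma gamgam_opp w : gamgam (- w) = gamgam w.
Proof. by rewrite /gamgam opprK mulrC. Qed.

Lemma gamgam_conj w : (gamgam w)^* = gamgam w^*.
Proof.
rewrite /gamgam /gam -!big_split rmorph_prod /=; apply: eq_bigr => i _.
rewrite rmorphM !fmorphV !rmorphB rmorphN /= (adm_imag sP) opprK.
by rewrite -!invfM; congr (_^-1); ring.
Qed.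

Lemma gamgam_prod w : w \notin sigma_pm ->
  (\prod_i (w - s i) * \prod_i (w + s i)) * gamgam w = (-1) ^+ n.
Proof.
move=> wr; rewrite gamgamE mulrCA -[RHS]mulr1; congr (_ * _).
rewrite big_sigma_pm -!big_split /= big1// => i _.
have [h1 h2] : w - s i != 0 /\ w + s i != 0.
  rewrite subr_eq0 addr_eq0; split; apply: contraNneq wr => e; apply/sigma_pmP; exists i.
    by left. by right.
by rewrite opprK; field; rewrite ?h1 ?h2.
Qed.

End PolesOfGamma.

(** * The transformed functions at a fixed parameter *)

Section Transform.
Local Open Scope ring_scope.
Context {R : realType}.
Local Notation C := R[i].

Definition chain_ratio n (A B : C -> C) (s : 'I_n -> C) w : C :=
  \det (echain_mx_append A B s w) / \det (echain_mx A B s).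

Definition chain_transform n (A B : C -> C) (s : 'I_n -> C) : C -> C :=
  fill (fun w => on_sigma s w || on_sigma s (- w))
    (fun w => gam s w * gam s (- w) * chain_ratio A B s w).

Lemma parity_swap eps A B : parity eps A B -> parity (- eps) B (fun w : C => - A w).
Proof.
case=> e0 Ao Bo; split=> [|w|w]; first by rewrite oppr_eq0.
  by rewrite Bo mulNr.
by rewrite Ao mulrNN.
Qed.

Variables (H : fspace R) (A B : C -> C) (D : kernel_space H A B).
Variables (n : nat) (s : 'I_n -> C) (sP : admissible s).
Hypothesis indep : linearly_independent (fun i => dbkernel A B (s i)).
Variables (eps : C) (par : parity eps A B).
Implicit Types (z w p : C) (P Q : {poly C}).
Local Notation N := (chain_ratio A B s).
Local Notation As := (chain_transform A B s).

Lemma chain_ratio_poly : exists c : nat -> C,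
  [/\ c n = 1, forall j, (c j)^* = c j &
      forall w, N w = (chain_poly1 n.+1 c).[w] * A w + (chain_poly2 n.+1 c).[w] * B w].
Proof.
have [c [c1 cr cE _]] := det_echain_ratio D sP indep par.
by exists c; split=> // w; rewrite /chain_ratio cE sum_echain.
Qed.

Lemma chain_ratio_opp w : N (- w) = eps * N w.
Proof.
have [c [_ _ cE _]] := det_echain_ratio D sP indep par.
rewrite /chain_ratio !cE mulr_sumr; apply: eq_bigr => j _.
by rewrite (echain_parity par) mulrCA.
Qed.

Lemma chain_ratio_eq0 p : p \in sigma_pm s -> N p = 0.
Proof.
have [c [_ _ cE c0]] := det_echain_ratio D sP indep par.
by case/sigma_pmP => i [->|->]; rewrite ?chain_ratio_opp /chain_ratio cE c0 ?mulr0.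
Qed.

Lemma sigma_pm_neq0 p : p \in sigma_pm s -> A p != 0.
Proof.
case/sigma_pmP => i [->|->]; first exact: (sigma_neq0 D sP indep i).1.
exact: (sigma_opp_neq0 D sP indep par i).
Qed.

Lemma chain_transform_off w : w \notin sigma_pm s -> As w = gamgam s w * N w.
Proof. by rewrite /chain_transform /fill on_sigma_pm => /negbTE ->. Qed.

(** At each pole the numerator has an entire quotient by
[linear_combination_quotient]. *)
Lemma chain_transform_entire : entire As.
Proof.
have [c [_ _ cE]] := chain_ratio_poly.
have h := @fill_prodV_entire R (sigma_pm s) _ ((-1) ^+ n) N _ (sigma_pm_uniq sP).
apply: h.
- by move=> w; rewrite unfold_in on_sigma_pm.
- by move=> w _; rewrite -[gam _ _ * _]/(gamgam s w) gamgamE.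
- move=> w; have -> : N = fun w' => (chain_poly1 n.+1 c).[w'] * A w' + (chain_poly2 n.+1 c).[w'] * B w'.
    exact/funext.
  exact: (cderivableD (cderivableM (@cderivable_horner _ _ w) (@ks_entire1 _ _ _ _ D w))
    (cderivableM (@cderivable_horner _ _ w) (@ks_entire2 _ _ _ _ D w))).
move=> p pr.
have A0 := sigma_pm_neq0 pr.
have A0' : A p^* != 0 by apply: sigma_pm_neq0; rewrite sigma_pm_conj.
have := chain_ratio_eq0 pr; rewrite cE => N0.
have [g ge gE] := linear_combination_quotient D A0 A0' N0.
by exists g => [|w]; [exact: ge|rewrite cE gE].
Qed.

(** Clear off the poles, and extended to them by continuity. *)
Lemma chain_transform_opp w : As (- w) = eps * As w.
Proof.
have off v : v \notin sigma_pm s -> As (- v) = eps * As v.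
  move=> vr; rewrite !chain_transform_off ?sigma_pm_opp// gamgam_opp chain_ratio_opp.
  by rewrite mulrCA.
have c1 : cont_at (fun v => As (- v)) w.
  by apply: cont_at_opp; exact: (cderivable_cont (@chain_transform_entire (- w))).
have c2 : cont_at (fun v => eps * As v) w.
  apply: cont_atM; first exact: cont_at_cst.
  exact: (cderivable_cont (@chain_transform_entire w)).
apply: (eq_punctured c1 c2).
by apply: filterS (dnear_notin (sigma_pm s) w) => v /off.
Qed.

Lemma real_on_realsP (f : C -> C) : real_on_reals f <-> forall t, t^* = t -> (f t)^* = f t.
Proof.
have key (z : C) : z^* = z <-> complex.Im z = 0.
  case: z => a b; rewrite -[(_ +i* _)^*]/(a -i* b); split=> [[] /eqP|/= ->].
    by rewrite eqNr => /eqP.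
  by rewrite oppr0.
split=> [fr t|fr t]; last by apply/key/fr/key.
case: t => a b /key /= ->; apply/key; exact: fr.
Qed.

(** The poles are nonzero imaginary numbers, so they avoid the real line. *)
Lemma chain_transform_real : real_on_reals A -> real_on_reals B -> real_on_reals As.
Proof.
have [c [_ cr cE]] := chain_ratio_poly.
move=> /real_on_realsP Ar /real_on_realsP Br; apply/real_on_realsP => t tr.
have tN : t \notin sigma_pm s.
  apply/sigma_pmP => -[i ti].
  have := adm_opp sP i i; have := adm_imag sP i.
  case: ti => [<-|]; first by rewrite tr => <-; rewrite eqxx.
  move/(congr1 -%R); rewrite opprK => <-; rewrite rmorphN /= tr => <-.
  by rewrite eqxx.
rewrite chain_transform_off// rmorphM /= (gamgam_conj sP) tr; congr (_ * _).
rewrite cE -sum_echain rmorph_sum; apply: eq_bigr => j _.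
rewrite rmorphM /= cr; congr (_ * _); rewrite /echain rmorphM rmorphXn rmorphD !rmorphM /=.
by rewrite tr Ar// Br// (chain_conj _).1 (chain_conj _).2.
Qed.

End Transform.

(** * The numerator of the new kernel *)

Section Decomposition.
Local Open Scope ring_scope.
Context {R : realType}.
Local Notation C := R[i].
Variables (H : fspace R) (A B : C -> C) (D : kernel_space H A B).
Variables (n : nat) (s : 'I_n -> C) (sP : admissible s).
Hypothesis indep : linearly_independent (fun i => dbkernel A B (s i)).
Variables (eps : C) (par : parity eps A B).
Implicit Types (z w p : C) (P Q : {poly C}).
Local Notation Z := (dbkernel A B).
Local Notation A' := (fun w : C => - A w).
Local Notation NA := (chain_ratio A B s).
Local Notation NB := (chain_ratio B A' s).
Local Notation As := (chain_transform A B s).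
Local Notation Bs := (chain_transform B A' s).

Let D' := kernel_space_swap D.
Let par' := parity_swap par.
Let indep' : linearly_independent (fun i => dbkernel B A' (s i)).
Proof. by rewrite dbkernel_swap. Qed.

Lemma chain_poly_conj m (c : nat -> C) z : (forall j, (c j)^* = c j) ->
  ((chain_poly1 m c).[z])^* = (chain_poly1 m c).[z^*] /\
  ((chain_poly2 m c).[z])^* = (chain_poly2 m c).[z^*].
Proof.
move=> cr; rewrite !horner_poly !rmorph_sum /=; split; apply: eq_bigr => j _;
by rewrite !rmorphM rmorphXn /= cr ?(chain_conj _).1 ?(chain_conj _).2.
Qed.

(** Partial fractions at the [n + 1] points of sigma and [z].  At the points of
sigma the numerator vanishes because both transforms do.  At [z] the values of
the coefficients factor through the determinant [P T + Q T2], whose roots are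
all known. *)
Lemma numerator_decomp z : z \notin sigma_pm s -> exists a : 'I_n -> C, forall w,
  dbnum NA NB z w = (z^* - w) * \prod_i (w + s i) *
   (\sum_i a i * Z (s i) w + (\prod_i (z^* - s i)) / 2 * Z z w).
Proof.
move=> zr.
have [c [cn cr cE]] := chain_ratio_poly D sP indep par.
have [d [dn dr dE]] := chain_ratio_poly D' sP indep' par'.
set P := chain_poly1 _ _ in cE; set Q := chain_poly2 _ _ in cE.
set T := chain_poly1 _ _ in dE; set T2 := chain_poly2 _ _ in dE.
pose M := P * T + Q * T2.
have [Mm Ms] : M \is monic /\ size M = n.*2.+1 by exact: chain_poly_monic.
(* [M] is the determinant of the matrix expressing both transforms through
   [A] and [B], which is singular wherever both transforms vanish. *)
have Mprod : M = \prod_(a <- sigma_pm s) ('X - a%:P).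
  rewrite [LHS](all_roots_prod_XsubC (rs := sigma_pm s)) ?(monicP Mm) ?scale1r//.
  - by rewrite Ms size_cat !(size_map _ (enum _)) size_enum_ord addnn.
  - apply/allP => a ar; rewrite /root !hornerE.
    have := chain_ratio_eq0 D sP indep par ar; rewrite cE => e1.
    have := chain_ratio_eq0 D' sP indep' par' ar; rewrite dE => e2.
    have := sigma_pm_neq0 D sP indep par ar => A0.
    rewrite -(mulIr_eq0 _ (mulIf A0)).
    have -> : (P.[a] * T.[a] + Q.[a] * T2.[a]) * A a =
      T.[a] * (P.[a] * A a + Q.[a] * B a) - Q.[a] * (T.[a] * B a + T2.[a] * - A a) by ring.
    by rewrite e1 e2 !mulr0 subr0.
  by rewrite uniq_rootsE sigma_pm_uniq.
pose u := append s z.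
pose b := (NB z)^*; pose a := (NA z)^*.
pose P1 := b *: P + a *: T2; pose Q1 := b *: Q - a *: T.
have bE : b = T.[z^*] * (B z)^* - T2.[z^*] * (A z)^*.
  rewrite /b dE rmorphD !rmorphM rmorphN /= (chain_poly_conj _ _ dr).1.
  by rewrite (chain_poly_conj _ _ dr).2 mulrN.
have aE : a = P.[z^*] * (A z)^* + Q.[z^*] * (B z)^*.
  by rewrite /a cE rmorphD !rmorphM /= (chain_poly_conj _ _ cr).1 (chain_poly_conj _ _ cr).2.
have numE w : dbnum NA NB z w = P1.[w] * A w + Q1.[w] * B w.
  by rewrite /dbnum -/a -/b cE dE /P1 /Q1 !hornerE; ring.
have szP : (size P1 <= n.+1)%N.
  by rewrite (leq_trans (size_polyD _ _))// geq_max !(leq_trans (size_scale_leq _ _)) ?size_poly.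
have szQ : (size Q1 <= n.+1)%N.
  rewrite (leq_trans (size_polyD _ _))// size_polyN geq_max.
  by rewrite !(leq_trans (size_scale_leq _ _)) ?size_poly.
have u_inj : injective u.
  move=> i j; rewrite /u /append.
  case: unliftP => [i' ->|->]; case: unliftP => [j' ->|->] //.
  - by move/(adm_inj sP) ->.
  - by move=> e; case/sigma_pmP: zr; exists i'; left.
  - by move=> e; case/sigma_pmP: zr; exists j'; left.
have s_in i : - s i \in sigma_pm s by apply/sigma_pmP; exists i; right.
have /choice[k kP] : forall i, exists k, [/\ P1.[(u i)^*] = k * (B (u i))^*,
    Q1.[(u i)^*] = k * - (A (u i))^* & i = ord_max -> k = M.[z^*]].
  move=> i; have [->|im] := eqVneq i ord_max.
    exists M.[z^*]; rewrite /u append_max /P1 /Q1 /M !hornerE bE aE.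
    by split=> //; ring.
  rewrite /u /append; case: unliftP => [i' _|i_max]; last by rewrite i_max eqxx in im.
  have [|k [k1 k2]] := @kernel_vector R H A B D n s sP indep eps par P1 Q1 i'.
    rewrite -numE /dbnum (chain_ratio_eq0 D sP indep par (s_in i')).
    by rewrite (chain_ratio_eq0 D' sP indep' par' (s_in i')) !mulr0 subrr.
  by exists k; split=> // e; rewrite e eqxx in im.
have PF := partial_fractions D u_inj szP szQ.
have kP1 i : P1.[(u i)^*] = k i * (B (u i))^* by have [] := kP i.
have kP2 i : Q1.[(u i)^*] = k i * - (A (u i))^* by have [] := kP i.
have kz : k ord_max = M.[z^*] by have [_ _ ->] := kP ord_max.
pose c' i := - (k i / \prod_(j | j != i) ((u i)^* - (u j)^*)) / 2.
exists (fun i => - c' (lift ord_max i)) => w.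
rewrite numE (PF k kP1 kP2) -/(c' _) !big_ord_recr /=.
have wl i : widen_ord (leqnSn n) i = lift ord_max i.
  by apply: val_inj; rewrite /= /bump leqNgt ltn_ord.
have ul i : u (widen_ord (leqnSn n) i) = s i by rewrite wl /u append_lift.
have um : u ord_max = z by rewrite /u append_max.
have -> : \prod_(i < n) (w - (u (widen_ord (leqnSn n) i))^*) = \prod_i (w + s i).
  by apply: eq_bigr => i _; rewrite ul (adm_imag sP) opprK.
have -> : - (k ord_max / \prod_(j | j != ord_max) ((u ord_max)^* - (u j)^*)) / 2 =
    - (\prod_i (z^* - s i) / 2).
  have -> : \prod_(j | j != ord_max) ((u ord_max)^* - (u j)^*) = \prod_i (z^* + s i).
    rewrite big_mkcond big_ord_recr /= eqxx mulr1 um; apply: eq_bigr => i _.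
    rewrite ul (adm_imag sP) opprK ifT// -val_eqE /=.
    by rewrite neq_ltn ltn_ord.
  rewrite kz Mprod horner_prod big_sigma_pm.
  have -> : \prod_(i < n) (('X - (s i)%:P).[z^*] * ('X - (- s i)%:P).[z^*]) =
    \prod_i (z^* - s i) * \prod_i (z^* + s i).
    by rewrite -big_split; apply: eq_bigr => i _; rewrite !hornerE opprK.
  rewrite mulfK ?mulNr//; apply/prodf_neq0 => i _; rewrite addr_eq0.
  by apply: contraNneq zr => e; rewrite -sigma_pm_conj// e s_in.
rewrite um.
set X := \sum_(i < n) _; have -> : X = - \sum_i - c' (lift ord_max i) * Z (s i) w.
  by rewrite -sumrN; apply: eq_bigr => i _; rewrite mulNr opprK ul /c' -wl ul.
by ring.
Qed.

End Decomposition.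

(** * Multiplication by gamma *)

Section GamMul.
Local Open Scope ring_scope.
Context {R : realType}.
Local Notation C := R[i].
Variables (n : nat) (s : 'I_n -> C) (s_inj : injective s).
Implicit Types (z w : C) (f : C -> C).

Lemma on_sigmaE w : on_sigma s w = (w \in [seq s i | i <- enum 'I_n]).
Proof.
apply/existsP/mapP => [[i /eqP e]|[i _ e]]; exists i => //.
  by rewrite mem_enum.
by rewrite e.
Qed.

Lemma gam_mul_off f w : ~~ on_sigma s w -> gam_mul s f w = gam s w * f w.
Proof. by rewrite /gam_mul /fill => /negbTE ->. Qed.

(** The zeros of [f] on sigma cancel the poles of gamma. *)
Lemma gam_mul_cont f : entire f -> (forall i, f (s i) = 0) ->
  forall w, cont_at (gam_mul s f) w.
Proof.
move=> fe f0.
apply: (@fill_prodV_cont R [seq s i | i <- enum 'I_n] _ 1 f).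
- by rewrite map_inj_uniq ?enum_uniq.
- by move=> w; rewrite -[RHS]on_sigmaE.
- by move=> w _; rewrite mul1r big_map /gam -big_enum.
- by move=> w; exact: (cderivable_cont (fe w)).
move=> _ /mapP[i _ ->]; have [q qc qE] := cderivable_quot (fe (s i)).
by exists q => // w; rewrite qE f0 add0r.
Qed.

Lemma prod_sub_cont w : cont_at (fun w => \prod_(i < n) (w - s i)) w.
Proof.
apply: cderivable_cont; apply: cderivable_prod => i.
exact: (cderivableD (@cderivable_id _ w) (@cderivable_cst _ (- s i) w)).
Qed.

Lemma gam_divK f : (forall w, cont_at f w) -> gam_mul s (gam_div s f) = f.
Proof.
move=> fc; apply/funext => w.
have off v : ~~ on_sigma s v -> gam s v * gam_div s f v = f v.
  move=> vs; rewrite /gam /gam_div mulrCA -big_split big1 ?mulr1// => i _ /=.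
  by rewrite mulVf// subr_eq0; apply: contraNneq vs => ->; apply/existsP; exists i.
have [ws|ws] := boolP (on_sigma s w); last by rewrite gam_mul_off ?off.
have K := @fill_near _ (on_sigma s) (fun w => gam s w * gam_div s f w) f w ws (fc w).
apply: nbhs_singleton (K _).
by apply: filterS (dnear_notin [seq s i | i <- enum 'I_n] w) => v;
  rewrite -on_sigmaE => vs; rewrite off.
Qed.

End GamMul.

(** * Evaluators of the modified space away from sigma and its opposite *)

Section ModifiedSpace.
Local Open Scope ring_scope.
Context {R : realType}.
Local Notation C := R[i].
Variables (H : fspace R) (A B : C -> C) (D : kernel_space H A B).
Variables (n : nat) (s : 'I_n -> C) (sP : admissible s).
Hypothesis indep : linearly_independent (fun i => dbkernel A B (s i)).
Variables (eps : C) (par : parity eps A B).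
Implicit Types (z w p : C) (P Q : {poly C}).
Local Notation Z := (dbkernel A B).
Local Notation A' := (fun w : C => - A w).
Local Notation NA := (chain_ratio A B s).
Local Notation NB := (chain_ratio B A' s).
Local Notation As := (chain_transform A B s).
Local Notation Bs := (chain_transform B A' s).
Local Notation K := (dbkernel As Bs).
Local Notation u := (fun z => gam_div s (K z)).

Let D' := kernel_space_swap D.
Let par' := parity_swap par.
Let indep' : linearly_independent (fun i => dbkernel B A' (s i)).
Proof. by rewrite dbkernel_swap. Qed.

Let Ase : entire As := chain_transform_entire D sP indep par.
Let Bse : entire Bs := chain_transform_entire D' sP indep' par'.

Lemma dbnum_transform z w : z \notin sigma_pm s -> w \notin sigma_pm s ->
  dbnum As Bs z w = gamgam s z^* * gamgam s w * dbnum NA NB z w.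
Proof.
move=> zr wr; rewrite /dbnum !chain_transform_off//.
rewrite [in LHS]rmorphM /= (gamgam_conj sP).
have -> : (gamgam s z * NA z)^* = gamgam s z^* * (NA z)^*.
  by rewrite rmorphM /= (gamgam_conj sP).
by ring.
Qed.

(** Known off the poles from the factor [z^* - w] of [numerator_decomp], and
extended by continuity in [z]. *)
Lemma dbnum_transform_conj_eq0 z : dbnum As Bs z z^* = 0.
Proof.
have off v : v \notin sigma_pm s -> dbnum As Bs v v^* = 0.
  move=> vr; have [a aE] := numerator_decomp D sP indep par vr.
  by rewrite dbnum_transform ?sigma_pm_conj// aE subrr !mul0r mulr0.
have c1 : cont_at (fun v => dbnum As Bs v v^*) z.
  apply: cont_atB; apply: cont_atM.
  - exact: (cont_conj (cderivable_cont (@Bse z))).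
  - exact: (cont_at_conj (cderivable_cont (@Ase z^*))).
  - exact: (cont_conj (cderivable_cont (@Ase z))).
  - exact: (cont_at_conj (cderivable_cont (@Bse z^*))).
apply: (eq_punctured c1 (@cont_at_cst _ 0 z)).
by apply: filterS (dnear_notin (sigma_pm s) z) => v /off.
Qed.

Lemma transform_kernel_cont z w : cont_at (K z) w.
Proof. exact: (dbkernel_cont (@Ase) (@Bse) (dbnum_transform_conj_eq0 z)). Qed.

Lemma gam_div_kernel_cont z w : cont_at (u z) w.
Proof. exact: (cont_atM (@transform_kernel_cont z w) (@prod_sub_cont _ _ s w)). Qed.

Lemma gam_conj z : (gam s z)^* = \prod_i (z^* + s i)^-1.
Proof.
rewrite /gam rmorph_prod; apply: eq_bigr => i _.
by rewrite fmorphV rmorphB /= (adm_imag sP) opprK.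
Qed.

(** The isometric image of the new kernel in [H] is the evaluator at [z] corrected
by evaluators of sigma.  Both sides are continuous, so the identity needs to be
checked only where no denominator vanishes. *)
Lemma gam_div_kernel_decomp z : z \notin sigma_pm s -> exists a : 'I_n -> C,
  u z = (fun w => (gam s z)^* * Z z w + \sum_i a i * Z (s i) w).
Proof.
move=> zr; have [a aE] := numerator_decomp D sP indep par zr.
(* What remains of the two factors [gamgam] of the transforms once the one in
   [w] has cancelled the products over sigma. *)
pose t := 2 * (-1) ^+ n * gamgam s z^*.
exists (fun i => t * a i); apply/funext => w.
pose h v := (gam s z)^* * Z z v + \sum_i (t * a i) * Z (s i) v.
have hH := ks_hilbert D.
have Zd := dbkernel_dom D.
have hc : cont_at h w.
  have he : entire h.
    apply: (dom_entire hH); apply: (domD hH (f := fun v => (gam s z)^* * Z z v)).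
      exact: domZ.
    exact: fdom_sum.
  exact: (cderivable_cont (he w)).
apply: (eq_punctured (@gam_div_kernel_cont z w) hc).
apply: filterS (dnear_notin (z^* :: sigma_pm s) w) => v.
rewrite inE negb_or => /andP[vz vr].
rewrite /gam_div dbkernel_off// dbnum_transform// aE.
have zv : z^* - v != 0 by rewrite subr_eq0 eq_sym.
have gv := gamgam_prod vr.
have gz : \prod_i (z^* - s i) * gamgam s z^* = (-1) ^+ n * (gam s z)^*.
  have := @gamgam_prod _ _ s z^*; rewrite sigma_pm_conj// => /(_ zr) <-.
  have YY : \prod_i (z^* + s i) * \prod_i (z^* + s i)^-1 = 1.
    rewrite -big_split big1// => i _ /=; rewrite divff//.
    rewrite addr_eq0; apply: contraNneq zr => e; rewrite -sigma_pm_conj//.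
    by apply/sigma_pmP; exists i; right.
  rewrite gam_conj; move: YY; move: (\prod_i (z^* - s i)) (\prod_i (z^* + s i)) (\prod_i _^-1).
  by move=> X Y Y' YY; rewrite -[LHS]mulr1 -YY; ring.
have -> : h v = 2 * (-1) ^+ n * gamgam s z^* *
   (\sum_i a i * Z (s i) v + \prod_i (z^* - s i) / 2 * Z z v).
  rewrite /h /t mulrDr mulr_sumr addrC; congr (_ + _).
    by apply: eq_bigr => i _; rewrite !mulrA.
  have -> : 2 * (-1) ^+ n * gamgam s z^* * (\prod_i (z^* - s i) / 2 * Z z v) =
    (-1) ^+ n * (\prod_i (z^* - s i) * gamgam s z^*) * Z z v by field.
  by rewrite gz mulrA -expr2 sqrr_sign mul1r.
set X := \sum_i _ + _; rewrite -gv; field.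
exact: zv.
Qed.

Lemma gam_div_kernel_dom_off z : z \notin sigma_pm s -> fdom H (u z).
Proof.
have hH := ks_hilbert D; have Zd := dbkernel_dom D.
move=> /gam_div_kernel_decomp[a ->]; apply: (domD hH (f := fun v => (gam s z)^* * Z z v)).
  exact: domZ.
exact: fdom_sum.
Qed.

(** The correcting terms are orthogonal to the functions vanishing on sigma. *)
Lemma gam_div_kernel_eval_off z f : z \notin sigma_pm s ->
  fdom H f -> (forall i, f (s i) = 0) ->
  gam_mul s f z = fprod H (u z) f.
Proof.
have hH := ks_hilbert D; have Zd := dbkernel_dom D.
move=> zr Hf f0; have [a ->] := gam_div_kernel_decomp zr.
rewrite gam_mul_off; last first.
  by apply: contra zr => /existsP[i /eqP e]; apply/sigma_pmP; exists i; left.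
rewrite (fprodDl hH (f := fun v => (gam s z)^* * Z z v)) ?fprodZl ?fprod_suml//.
- rewrite conjCK -(ks_eval D).2// big1 ?addr0// => i _.
  by rewrite -(ks_eval D).2// f0 mulr0.
- exact: domZ.
exact: fdom_sum.
Qed.

End ModifiedSpace.

(** * Joint continuity of a kernel *)

Section JointContinuity.
Local Open Scope ring_scope.
Context {R : realType}.
Local Notation C := R[i].

Lemma dbkernel_cvg T (F : set_system T) {FF : Filter F} (A B : C -> C)
    (x y : T -> C) (z w : C) :
  entire A -> entire B -> w != z^* ->
  (x t : C^o) @[t --> F] --> (z : C^o) -> (y t : C^o) @[t --> F] --> (w : C^o) ->
  (dbkernel A B (x t) (y t) : C^o) @[t --> F] --> (dbkernel A B z w : C^o).
Proof.
move=> Ae Be wz xz yw.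
have compc (f : C -> C) (v : T -> C) (l : C) : entire f ->
    (v t : C^o) @[t --> F] --> (l : C^o) -> (f (v t) : C^o) @[t --> F] --> (f l : C^o).
  move=> fe vl; exact: (cvg_comp _ _ vl (cderivable_cont (fe l))).
have dc : ((x t)^* - y t : C^o) @[t --> F] --> (z^* - w : C^o).
  exact: (cvgB (cvg_conj xz) yw).
have d0 : z^* - w != 0 by rewrite subr_eq0 eq_sym.
have nc : (2 * dbnum A B (x t) (y t) / ((x t)^* - y t) : C^o) @[t --> F] -->
    (2 * dbnum A B z w / (z^* - w) : C^o).
  apply: (@cvgM C _ F FF (fun t => 2 * dbnum A B (x t) (y t)) (fun t => ((x t)^* - y t)^-1)).
    apply: (@cvgM C _ F FF (fun t => 2) (fun t => dbnum A B (x t) (y t))); first exact: cvg_cst.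
    apply: (@cvgB C C^o _ F FF (fun t => (B (x t))^* * A (y t)) (fun t => (A (x t))^* * B (y t))).
      exact: (cvgM (cvg_conj (compc _ _ _ Be xz)) (compc _ _ _ Ae yw)).
    exact: (cvgM (cvg_conj (compc _ _ _ Ae xz)) (compc _ _ _ Be yw)).
  exact: (cvgV d0 dc).
rewrite (dbkernel_off _ _ wz).
have e : \forall t \near F, 2 * dbnum A B (x t) (y t) / ((x t)^* - y t) = dbkernel A B (x t) (y t).
  have := @cvgr_dist_lt C C^o _ _ FF _ _ dc `|z^* - w|; rewrite normr_gt0 => /(_ d0).
  apply: filterS => t h; rewrite dbkernel_off//.
  by apply: contraTneq h => ->; rewrite subrr subr0 ltxx.
exact: cvg_trans (near_eq_cvg e) nc.
Qed.

End JointContinuity.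

(** * Evaluators of the modified space at all points *)

Section ModifiedLimit.
Local Open Scope ring_scope.
Context {R : realType}.
Local Notation C := R[i].
Variables (H : fspace R) (A B : C -> C) (D : kernel_space H A B).
Variables (n : nat) (s : 'I_n -> C) (sP : admissible s).
Hypothesis indep : linearly_independent (fun i => dbkernel A B (s i)).
Variables (eps : C) (par : parity eps A B).
Implicit Types (z w p : C) (P Q : {poly C}).
Local Notation A' := (fun w : C => - A w).
Local Notation As := (chain_transform A B s).
Local Notation Bs := (chain_transform B A' s).
Local Notation K := (dbkernel As Bs).
Local Notation u := (fun z => gam_div s (K z)).

Let D' := kernel_space_swap D.
Let par' := parity_swap par.
Let indep' : linearly_independent (fun i => dbkernel B A' (s i)).
Proof. by rewrite dbkernel_swap. Qed.

Let Ase : entire As := chain_transform_entire D sP indep par.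
Let Bse : entire Bs := chain_transform_entire D' sP indep' par'.

Let Kc z w : cont_at (K z) w := @transform_kernel_cont _ _ _ _ D _ _ sP indep _ par z w.

Lemma gam_div_sigma (f : C -> C) i : gam_div s f (s i) = 0.
Proof. by rewrite /gam_div (bigD1 i)//= subrr mul0r mulr0. Qed.

(** A point [z] of sigma or its opposite is approached along the horizontal
sequence [zs], which avoids all these imaginary points. *)
Section AtSigma.
Variables (z : C) (zr : z \in sigma_pm s).

Let zs k : C := z + (k.+1%:R^-1)%:C.

Let zc : z^* = - z.
Proof.
have c i := adm_imag sP i.
by case/sigma_pmP: zr => i [->|->]; rewrite ?rmorphN /= c.
Qed.

Let z0 : z != 0.
Proof.
apply/eqP => z0; case/sigma_pmP: zr => i; rewrite z0 => -[/esym|/eqP].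
  by move=> e; have := adm_opp sP i i; rewrite e oppr0 eqxx.
rewrite eq_sym oppr_eq0 => /eqP e.
by have := adm_opp sP i i; rewrite e oppr0 eqxx.
Qed.

Let zzc : z != z^*.
Proof. by rewrite zc -addr_eq0 -mulr2n mulrn_eq0. Qed.

Let zs_off k : zs k \notin sigma_pm s.
Proof.
have c i := adm_imag sP i.
apply/negP => kr; have kc : (zs k)^* = - zs k.
  by case/sigma_pmP: kr => i [->|->]; rewrite ?rmorphN /= c.
have t0 : (k.+1%:R^-1 : R) != 0 by rewrite invr_eq0 pnatr_eq0.
have tr : ((k.+1%:R^-1 : R)%:C)^* = (k.+1%:R^-1 : R)%:C := conjc_real _.
move: kc; rewrite /zs rmorphD /= zc tr opprD => /addrI/eqP.
by rewrite -addr_eq0 -mulr2n mulrn_eq0 /= eq_complex /= (negbTE t0).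
Qed.

Let zs_cvg : (zs k : C^o) @[k --> \oo] --> (z : C^o).
Proof. exact: cvg_shift_harmonic. Qed.

Let u_dom k : fdom H (u (zs k)).
Proof. exact: (gam_div_kernel_dom_off D sP indep par (zs_off k)). Qed.

Let u_eval k f : fdom H f -> (forall i, f (s i) = 0) ->
  gam_mul s f (zs k) = fprod H (u (zs k)) f.
Proof. exact: (gam_div_kernel_eval_off D sP indep par (zs_off k)). Qed.

Let u_prod k l : fprod H (u (zs k)) (u (zs l)) = K (zs l) (zs k).
Proof.
rewrite -u_eval//; last by move=> i; exact: gam_div_sigma.
by rewrite (gam_divK s (@Kc (zs l))).
Qed.

Let K_joint (e : C) : 0 < e -> exists N, forall k l, (N <= k)%N -> (N <= l)%N ->
  `|K z z - K (zs k) (zs l)| < e.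
Proof.
move=> e0.
have c1 : (zs p.1 : C^o) @[p --> filter_prod \oo \oo] --> (z : C^o).
  exact: (cvg_comp _ _ cvg_fst zs_cvg).
have c2 : (zs p.2 : C^o) @[p --> filter_prod \oo \oo] --> (z : C^o).
  exact: (cvg_comp _ _ cvg_snd zs_cvg).
have FF : Filter (filter_prod \oo \oo : set_system (nat * nat)) by exact: filter_prod_filter.
have h := @dbkernel_cvg _ _ _ FF _ _ _ _ _ _ Ase Bse zzc c1 c2.
have [[P Q] /= [[N1 _ PN] [N2 _ QN]] PQ] := @cvgr_dist_lt C C^o _ _ FF _ _ h e e0.
exists (maxn N1 N2) => k l; rewrite !geq_max => /andP[k1 _] /andP[_ l2].
by apply: (PQ (k, l)); split; [apply: PN|apply: QN].
Qed.

(** The square of the distance is a sum of four values of the kernel near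
[(z, z)], with two signs of each kind. *)
Let u_cauchy (e : R) : 0 < e -> exists N, forall k l, (N <= k)%N -> (N <= l)%N ->
  fnorm H (u (zs k) \- u (zs l)) < e.
Proof.
move=> e0; have hH := ks_hilbert D.
(* Four kernel values, each within [e ^+ 2 / 4] of [K z z]. *)
have e4 : 0 < (e ^+ 2 / 4)%:C by rewrite ltcR divr_gt0 ?exprn_gt0.
have [N KN] := K_joint e4; exists N => k l Nk Nl.
have n0 : 0 <= fnorm H (u (zs k) \- u (zs l)) by rewrite sqrtr_ge0.
rewrite -(@ltr_pXn2r _ 2)// ?nnegrE ?(ltW e0)//.
have dd : fdom H (u (zs k) \- u (zs l)) by apply: fdomB.
rewrite -ltcR -(fnorm_sqr hH)// -(ger0_norm (fprod_ge0 hH dd)).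
rewrite (fprodBl hH)// !(fprodBr hH)// !u_prod.
have -> : (e ^+ 2)%:C = (e ^+ 2 / 4)%:C + (e ^+ 2 / 4)%:C + (e ^+ 2 / 4)%:C + (e ^+ 2 / 4)%:C.
  by rewrite -!rmorphD /=; congr (_%:C); field.
have := KN _ _ Nk Nk; have := KN _ _ Nk Nl; have := KN _ _ Nl Nk; have := KN _ _ Nl Nl.
set x := K (zs k) (zs k); set y := K (zs l) (zs k).
set x' := K (zs k) (zs l); set y' := K (zs l) (zs l) => h1 h2 h3 h4.
have -> : x - y - (x' - y') = - (K z z - x) + (K z z - y) + (K z z - x') - (K z z - y').
  by ring.
apply: (le_lt_trans (ler_normB _ _)); apply: ltrD h1.
apply: (le_lt_trans (ler_normD _ _)); apply: ltrD h3.
apply: (le_lt_trans (ler_normD _ _)); rewrite normrN; exact: ltrD h4 h2.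
Qed.

(** The limit in [H] exists by completeness.  Evaluation identifies it with the
new kernel at [z], except at [z^*], where both are continuous. *)
Lemma gam_div_kernel_limit : fdom H (u z) /\
  forall f, fdom H f -> (forall i, f (s i) = 0) -> gam_mul s f z = fprod H (u z) f.
Proof.
have hH := ks_hilbert D.
have [f0 Hf0 uf0] := fcomplete hH u_dom u_cauchy.
have f0c w : cont_at f0 w by exact: (cderivable_cont (@dom_entire _ _ hH _ Hf0 w)).
have f0E : f0 = u z.
  have off w : w != z^* -> f0 w = u z w.
    move=> wz.
    have c1 := @cvg_eval _ _ hH _ _ w u_dom Hf0 uf0.
    have c2 : (K (zs k) w : C^o) @[k --> \oo] --> (K z w : C^o).
      exact: (dbkernel_cvg Ase Bse wz zs_cvg (cvg_cst (w : C^o))).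
    have c3 : (u (zs k) w : C^o) @[k --> \oo] --> (u z w : C^o).
      exact: (cvgM c2 (cvg_cst (\prod_(i < n) (w - s i) : C^o))).
    exact: (cvg_unique (@norm_hausdorff C C^o) c1 c3).
  apply/funext => w; have [->|] := eqVneq w z^*; last exact: off.
  apply: (eq_punctured (@f0c _) (@gam_div_kernel_cont _ _ _ _ D _ _ sP indep _ par z z^*)).
  by apply/dnearcP; exists 1 => // w' wz _; exact: off.
rewrite -f0E; split=> // f Hf fs.
have c1 := cvg_fprod hH u_dom Hf0 Hf uf0.
have c2 : (gam_mul s f (zs k) : C^o) @[k --> \oo] --> (gam_mul s f z : C^o).
  have fe := dom_entire hH Hf.
  exact: (cvg_comp _ _ zs_cvg (@gam_mul_cont _ _ _ (adm_inj sP) f (fun w => fe w) fs z)).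
have c3 : (fprod H (u (zs k)) f : C^o) @[k --> \oo] --> (gam_mul s f z : C^o).
  have -> : (fun k => fprod H (u (zs k)) f) = (fun k => gam_mul s f (zs k)).
    by apply/funext => k; rewrite u_eval.
  exact: c2.
exact: (cvg_unique (@norm_hausdorff C C^o) c3 c1).
Qed.

End AtSigma.

Lemma gam_div_kernel_dom_eval z : fdom H (u z) /\
  forall f, fdom H f -> (forall i, f (s i) = 0) -> gam_mul s f z = fprod H (u z) f.
Proof.
have [zr|zr] := boolP (z \in sigma_pm s); first exact: gam_div_kernel_limit.
split; first exact: (gam_div_kernel_dom_off D sP indep par zr).
by move=> f; exact: (gam_div_kernel_eval_off D sP indep par zr).
Qed.

Lemma modified_evaluators : evaluators (modified s H) K.
Proof.
split=> [z|z _ [f [Hf fs] <-]] /=.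
  exists (u z); last exact: (gam_divK s (@Kc z)).
  by split=> [|i]; [exact: (gam_div_kernel_dom_eval z).1|exact: gam_div_sigma].
by rewrite gam_mulK// (gam_div_kernel_dom_eval z).2.
Qed.

End ModifiedLimit.

(** * Complex functions of a real variable *)

Section RealDerivative.
Local Open Scope ring_scope.
Context {R : realType}.
Local Notation C := R[i].
Implicit Types (f g : R -> C) (x t : R) (d c : C).

Definition is_deriveC f x d : Prop :=
  is_derive x (1 : R) (fun t => complex.Re (f t)) (complex.Re d) /\
  is_derive x (1 : R) (fun t => complex.Im (f t)) (complex.Im d).

Lemma is_deriveC_derivable f x d : is_deriveC f x d -> derivableC f x.
Proof. by case=> [[? _] [? _]]; split. Qed.

Lemma is_deriveC_eq f x d : is_deriveC f x d -> deriveC f x = d.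
Proof. by case: d => a b [[_ ea] [_ eb]]; rewrite /deriveC !derive1E ea eb. Qed.

Lemma derivableC_is_derive f x : derivableC f x -> is_deriveC f x (deriveC f x).
Proof. by case=> ra ia; split; rewrite /deriveC /= derive1E; exact: derivableP. Qed.

Lemma is_deriveC_cst c x : is_deriveC (fun=> c) x 0.
Proof. by split; exact: is_derive_cst. Qed.

Lemma is_deriveC_add f g x d e : is_deriveC f x d -> is_deriveC g x e ->
  is_deriveC (fun t => f t + g t) x (d + e).
Proof.
move=> [fr fi] [gr gi]; rewrite /is_deriveC.
have -> : (fun t => complex.Re (f t + g t)) = (fun t => complex.Re (f t)) + (fun t => complex.Re (g t)).
  by apply/funext => t /=; rewrite fctE; case: (f t) (g t) => [? ?] [? ?].
have -> : (fun t => complex.Im (f t + g t)) = (fun t => complex.Im (f t)) + (fun t => complex.Im (g t)).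
  by apply/funext => t /=; rewrite fctE; case: (f t) (g t) => [? ?] [? ?].
have -> : complex.Re (d + e) = complex.Re d + complex.Re e by case: d e {fr fi gr gi} => [? ?] [? ?].
have -> : complex.Im (d + e) = complex.Im d + complex.Im e by case: d e {fr fi gr gi} => [? ?] [? ?].
by split; exact: is_deriveD.
Qed.

Lemma is_deriveC_mul f g x d e : is_deriveC f x d -> is_deriveC g x e ->
  is_deriveC (fun t => f t * g t) x (d * g x + f x * e).
Proof.
move=> [fr fi] [gr gi]; rewrite /is_deriveC.
set a := (fun t => complex.Re (f t)) in fr; set b := (fun t => complex.Im (f t)) in fi.
set a' := (fun t => complex.Re (g t)) in gr; set b' := (fun t => complex.Im (g t)) in gi.
have -> : (fun t => complex.Re (f t * g t)) = a * a' - b * b'.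
  by apply/funext => t /=; rewrite !fctE /a /b /a' /b'; case: (f t) (g t) => [? ?] [? ?].
have -> : (fun t => complex.Im (f t * g t)) = a * b' + b * a'.
  by apply/funext => t /=; rewrite !fctE /a /b /a' /b'; case: (f t) (g t) => [? ?] [? ?].
split.
  apply: (is_derive_eq (is_deriveB (is_deriveM fr gr) (is_deriveM fi gi))).
  rewrite /a /b /a' /b'; case: d e (f x) (g x) {fr fi gr gi} => [? ?] [? ?] [? ?] [? ?] /=.
  by rewrite /GRing.scale /=; ring.
apply: (is_derive_eq (is_deriveD (is_deriveM fr gi) (is_deriveM fi gr))).
rewrite /a /b /a' /b'; case: d e (f x) (g x) {fr fi gr gi} => [? ?] [? ?] [? ?] [? ?] /=.
by rewrite /GRing.scale /=; ring.
Qed.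

(** The inverse is computed from the real and imaginary parts divided by the
square [N] of the modulus. *)
Lemma is_deriveC_inv f x d : f x != 0 -> is_deriveC f x d ->
  is_deriveC (fun t => (f t)^-1) x (- d * (f x)^-1 * (f x)^-1).
Proof.
move=> f0 [fr fi]; rewrite /is_deriveC.
set a := (fun t => complex.Re (f t)) in fr; set b := (fun t => complex.Im (f t)) in fi.
pose N : R -> R := a * a + b * b.
have N0 : N x != 0.
  move: f0; apply: contraNneq; rewrite /N !fctE /a /b; case: (f x) => p q /= /eqP.
  by rewrite -!expr2 paddr_eq0 ?sqr_ge0// !sqrf_eq0 => /andP[/eqP-> /eqP->].
have dN := is_deriveD (is_deriveM fr fr) (is_deriveM fi fi).
have [Nd Ne] := dN.
have dV : is_derive x (1 : R) (fun t => (N t)^-1)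
    (- (N x) ^- 2 *: (a x *: complex.Re d + a x *: complex.Re d +
     (b x *: complex.Im d + b x *: complex.Im d))).
  by rewrite -Ne; split; [exact: derivableV|exact: deriveV].
have -> : (fun t => complex.Re (f t)^-1) = a * (fun t => (N t)^-1).
  by apply/funext => t /=; rewrite /N !fctE /a /b; case: (f t) => p q /=; rewrite -!expr2.
have -> : (fun t => complex.Im (f t)^-1) = - (b * (fun t => (N t)^-1)).
  by apply/funext => t /=; rewrite /N !fctE /a /b; case: (f t) => p q /=; rewrite -!expr2.
split.
  apply: (is_derive_eq (is_deriveM fr dV)).
  move: N0; rewrite /N !fctE /a /b; case: d (f x) {fr fi dN dV Nd Ne} => [? ?] [? ?] /= N0.
  by rewrite /GRing.scale /= ; field.
apply: (is_derive_eq (is_deriveN (is_deriveM fi dV))).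
move: N0; rewrite /N !fctE /a /b; case: d (f x) {fr fi dN dV Nd Ne} => [? ?] [? ?] /= N0.
by rewrite /GRing.scale /= ; field.
Qed.

Variables (I : set R) (I_open : open I).

(** Two functions agreeing on the open set [I] agree near each of its points. *)
Lemma is_deriveC_ext f g x d : (forall t, I t -> f t = g t) -> I x ->
  is_deriveC f x d -> is_deriveC g x d.
Proof.
move=> fg Ix [fr fi].
have n : \forall t \near x, f t = g t.
  by apply: filterS (open_nbhs_nbhs (conj I_open Ix)) => t /fg.
have nr : \forall t \near x, complex.Re (f t) = complex.Re (g t).
  by apply: filterS n => t ->.
have ni : \forall t \near x, complex.Im (f t) = complex.Im (g t).
  by apply: filterS n => t ->.
by split; [exact: near_eq_is_derive nr fr|exact: near_eq_is_derive ni fi].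
Qed.

End RealDerivative.

(** * Repeated differentiability *)

Section Smooth.
Local Open Scope ring_scope.
Context {R : realType}.
Local Notation C := R[i].
Variables (I : set R) (I_open : open I).
Implicit Types (f g : R -> C) (x t : R) (d c : C).

Lemma derivableC_upto0 f : derivableC_upto 0 I f. Proof. by case. Qed.

(** Allows induction on the order of differentiability. *)
Lemma derivableC_uptoS r f : derivableC_upto r.+1 I f <->
  (forall x, I x -> derivableC f x) /\ derivableC_upto r I (deriveC f).
Proof.
split=> [fr|[f1 fr] [_ x Ix|k kr x Ix]]; last 2 first.
- exact: f1.
- by rewrite iterSr; exact: fr.
split=> [x Ix|k kr x Ix]; first exact: (fr 0%N).
by rewrite -iterSr; exact: fr.
Qed.

Lemma derivableC_upto_le r r' f : (r <= r')%N ->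
  derivableC_upto r' I f -> derivableC_upto r I f.
Proof. by move=> rr' fr k kr; apply: fr; exact: leq_trans rr'. Qed.

Lemma derivableC_upto_ext r f g : (forall t, I t -> f t = g t) ->
  derivableC_upto r I f -> derivableC_upto r I g.
Proof.
elim: r f g => [|r IH] f g fg; first by move=> _; exact: derivableC_upto0.
move=> /derivableC_uptoS[f1 fr]; apply/derivableC_uptoS.
have g1 x : I x -> is_deriveC g x (deriveC f x).
  by move=> Ix; apply: (is_deriveC_ext I_open fg Ix); apply/derivableC_is_derive/f1.
split=> [x Ix|]; first exact: is_deriveC_derivable (g1 x Ix).
apply: IH fr => t It; exact/esym/is_deriveC_eq/g1.
Qed.

Lemma derivableC_upto_is_derive r f f' : (forall x, I x -> is_deriveC f x (f' x)) ->
  derivableC_upto r I f' -> derivableC_upto r.+1 I f.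
Proof.
move=> ff' f'r; apply/derivableC_uptoS; split=> [x Ix|]; first exact: is_deriveC_derivable (ff' x Ix).
by apply: derivableC_upto_ext f'r => t It; exact/esym/is_deriveC_eq/ff'.
Qed.

Lemma derivableC_upto_cst r c : derivableC_upto r I (fun=> c).
Proof.
elim: r c => [|r IH] c; first exact: derivableC_upto0.
apply: (@derivableC_upto_is_derive _ _ (fun=> 0)); last exact: IH.
by move=> x _; exact: is_deriveC_cst.
Qed.

Lemma derivableC_upto_add r f g : derivableC_upto r I f -> derivableC_upto r I g ->
  derivableC_upto r I (fun t => f t + g t).
Proof.
elim: r f g => [|r IH] f g; first by move=> _ _; exact: derivableC_upto0.
move=> /derivableC_uptoS[f1 fr] /derivableC_uptoS[g1 gr].
apply: (@derivableC_upto_is_derive _ _ (fun t => deriveC f t + deriveC g t)); last exact: IH.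
by move=> x Ix; apply: is_deriveC_add; apply: derivableC_is_derive; [exact: f1|exact: g1].
Qed.

Lemma derivableC_upto_mul r f g : derivableC_upto r I f -> derivableC_upto r I g ->
  derivableC_upto r I (fun t => f t * g t).
Proof.
elim: r f g => [|r IH] f g fS gS; first exact: derivableC_upto0.
have /derivableC_uptoS[f1 fr] := fS; have /derivableC_uptoS[g1 gr] := gS.
apply: (@derivableC_upto_is_derive _ _ (fun t => deriveC f t * g t + f t * deriveC g t)).
  by move=> x Ix; apply: is_deriveC_mul; apply: derivableC_is_derive; [exact: f1|exact: g1].
have fr' := derivableC_upto_le (leqnSn r) fS; have gr' := derivableC_upto_le (leqnSn r) gS.
exact: (derivableC_upto_add (IH _ _ fr gr') (IH _ _ fr' gr)).
Qed.

Lemma derivableC_upto_inv r f : (forall t, I t -> f t != 0) -> derivableC_upto r I f ->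
  derivableC_upto r I (fun t => (f t)^-1).
Proof.
move=> f0; elim: r => [|r IH] fS; first exact: derivableC_upto0.
have /derivableC_uptoS[f1 fr] := fS.
apply: (@derivableC_upto_is_derive _ _ (fun t => - deriveC f t * (f t)^-1 * (f t)^-1)).
  by move=> x Ix; apply: is_deriveC_inv; [exact: f0|exact/derivableC_is_derive/f1].
have fV : derivableC_upto r I (fun t => (f t)^-1) by apply/IH/(derivableC_upto_le (leqnSn r)).
have dN : derivableC_upto r I (fun t => - deriveC f t).
  have := derivableC_upto_mul (@derivableC_upto_cst r (-1)) fr; apply: derivableC_upto_ext => t _.
  by rewrite mulN1r.
exact: (derivableC_upto_mul (derivableC_upto_mul dN fV) fV).
Qed.

End Smooth.

(** * Wronskians as determinants without derivatives *)

Section WronskianChain.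
Local Open Scope ring_scope.
Context {R : realType}.
Local Notation C := R[i].
Variables (I : set R) (I_open : open I) (n : nat) (A B : R -> C -> C) (mu : R -> C).
Hypotheses
  (dA : forall x w, I x -> is_deriveC (fun t => A t w) x (mu x * A x w - w * B x w))
  (dB : forall x w, I x -> is_deriveC (fun t => B t w) x (- mu x * B x w + w * A x w))
  (mu_smooth : derivableC_upto n.-1 I mu).
Implicit Types (x t : R) (w : C).

(** Coefficient of the [j]-th term of the chain in the [k]-th derivative of [A].
The recursion is the product rule together with [is_deriveC_echain]. *)
Fixpoint chain_coef (k j : nat) : R -> C :=
  if k is k'.+1 then
    fun t => deriveC (chain_coef k' j) t + (-1) ^+ j * mu t * chain_coef k' j t
             + (if j is j'.+1 then chain_coef k' j' t else 0)
  else fun=> (j == 0)%:R.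

(** Each derivation costs one order, and [mu] enters only from the first
derivative on, so [n - 1] orders are enough for it. *)
Lemma chain_coef_smooth k j : (k <= n)%N ->
  derivableC_upto (n - k) I (chain_coef k j).
Proof.
elim: k j => [|k IH] j kn /=; first exact: derivableC_upto_cst.
have kS : (n - k = (n - k.+1).+1)%N by lia.
have H i := IH i (ltnW kn).
have H' i : derivableC_upto (n - k.+1) I (chain_coef k i).
  have hk : (n - k.+1 <= n - k)%N by lia.
  exact: (derivableC_upto_le hk (H i)).
apply: (derivableC_upto_add I_open); first apply: (derivableC_upto_add I_open).
- by have := H j; rewrite kS => /derivableC_uptoS[].
- have hk : (n - k.+1 <= n.-1)%N by lia.
  exact: (derivableC_upto_mul I_open (derivableC_upto_mul I_open
    (@derivableC_upto_cst _ _ I_open _ _) (derivableC_upto_le hk mu_smooth)) (H' j)).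
by case: j => [|j]; [exact: derivableC_upto_cst|exact: H'].
Qed.

Lemma deriveC_cst (c : C) : deriveC (fun=> c) = (fun=> 0) :> (R -> C).
Proof. by apply/funext => t; exact/is_deriveC_eq/is_deriveC_cst. Qed.

Lemma chain_coef_gt k j : (k < j)%N -> chain_coef k j = fun=> 0.
Proof.
elim: k j => [|k IH] [|j] //= kj; apply/funext => t.
by rewrite !IH ?deriveC_cst ?mulr0 ?addr0//; lia.
Qed.

Lemma chain_coef_diag k : chain_coef k k = fun=> 1.
Proof.
elim: k => [|k IH] //=; apply/funext => t.
by rewrite IH chain_coef_gt// deriveC_cst mulr0 !add0r.
Qed.

Lemma is_deriveC_echain j x w : I x -> is_deriveC (fun t => echain (A t) (B t) j w) x
  ((-1) ^+ j * mu x * echain (A x) (B x) j w + echain (A x) (B x) j.+1 w).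
Proof.
move=> Ix; have [s1 s2] := chain_sign C j.
have h := is_deriveC_mul (is_deriveC_cst (w ^+ j) x) (is_deriveC_add
  (is_deriveC_mul (is_deriveC_cst (chain C j).1 x) (dA w Ix))
  (is_deriveC_mul (is_deriveC_cst (chain C j).2 x) (dB w Ix))).
rewrite /echain; move: h; congr (is_deriveC _ _ _).
transitivity (mu x * w ^+ j *
    (((-1) ^+ j * (chain C j).1) * A x w + ((-1) ^+ j * (chain C j).2) * B x w)
  + w ^+ j.+1 * ((chain C j).2 * A x w - (chain C j).1 * B x w)).
  by rewrite s1 s2 exprS; ring.
by rewrite /= exprS; ring.
Qed.

Lemma is_deriveC_sum m (F : 'I_m -> R -> C) (d : 'I_m -> C) x :
  (forall i, is_deriveC (F i) x (d i)) -> is_deriveC (fun t => \sum_i F i t) x (\sum_i d i).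
Proof.
elim: m F d => [|m IH] F d Fd.
  rewrite big_ord0; have := is_deriveC_cst 0 x; congr (is_deriveC _ _ _).
  by apply/funext => t; rewrite big_ord0.
rewrite big_ord_recl; have := is_deriveC_add (Fd ord0) (IH _ _ (fun i => Fd (lift ord0 i))).
congr (is_deriveC _ _ _).
by apply/funext => t; rewrite big_ord_recl.
Qed.

Lemma iter_deriveC_chain m k w x : (k <= n)%N -> (k < m)%N -> I x ->
  iter k deriveC (fun t => A t w) x =
  \sum_(j < m) chain_coef k j x * echain (A x) (B x) j w.
Proof.
move=> + km; elim: k km x => [|k IH] km x kn Ix.
  case: m km => // m _; rewrite big_ord_recl big1 ?addr0 => [|j _] /=.
    by rewrite /echain /= expr0 !mul1r mul0r addr0.
  by rewrite mul0r.
have e (t : R) (It : I t) := IH (ltnW km) t (ltnW kn) It.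
rewrite iterS; apply: is_deriveC_eq.
apply: (is_deriveC_ext I_open (fun t It => esym (e t It)) Ix).
have lS (j : 'I_m) : is_deriveC (chain_coef k j) x (deriveC (chain_coef k j) x).
  apply: derivableC_is_derive; have := chain_coef_smooth j (ltnW kn).
  have -> : (n - k = (n - k.+1).+1)%N by lia.
  by move=> /derivableC_uptoS[+ _]; apply.
have := is_deriveC_sum (fun j : 'I_m => is_deriveC_mul (lS j) (is_deriveC_echain j w Ix)).
congr (is_deriveC _ _ _).
case: m km {e IH lS} => // m km.
under eq_bigr do rewrite mulrDr addrA.
rewrite big_split /=.
(* The terms with index [j.+1] are shifted by one; the last one is zero. *)
rewrite [X in _ + X]big_ord_recr /= (chain_coef_gt (k := k) (j := m))// mul0r addr0.
rewrite [in RHS]big_ord_recl /= [X in X + _ = _]big_ord_recl /= addr0 -addrA -big_split /=.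
congr (_ + _); first by ring.
by apply: eq_bigr => j _; rewrite /bump /= add1n; ring.
Qed.

(** The Wronskian matrix is the product of the triangular matrix of the
coefficients, with diagonal 1, and of the matrix of values of the chain. *)
Lemma wronskian_chain m (s : 'I_m -> C) x : (m <= n.+1)%N -> I x ->
  wronskian_of A s x = \det (\matrix_(j, i) echain (A x) (B x) j (s i) : 'M[C]_m).
Proof.
move=> mn Ix; rewrite /wronskian_of /wronskian.
pose L : 'M[C]_m := \matrix_(k, j) chain_coef k j x.
have -> : (\matrix_(i, j) iter i deriveC (fun t => A t (s j)) x : 'M[C]_m) =
    L *m (\matrix_(j, i) echain (A x) (B x) j (s i)).
  apply/matrixP => i j; rewrite !mxE (iter_deriveC_chain (m := m))//.
    by apply: eq_bigr => k _; rewrite !mxE.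
  by have := ltn_ord i; lia.
rewrite det_mulmx det_trig.
  by rewrite big1 ?mul1r// => i _; rewrite mxE chain_coef_diag.
by apply/is_trig_mxP => i j ij; rewrite mxE chain_coef_gt.
Qed.

End WronskianChain.

(** * The transformed family of spaces *)

Theorem theorem8 (R : realType) (I : set R) (H : R -> fspace R)
    (A B : R -> R[i] -> R[i]) (mu : R -> R) (n : nat) (s : 'I_n -> R[i])
    (* the parameter x ranges over an open interval *)
    (I_open : open I) (I_itv : is_interval I)
    (H_hilbert : forall x, I x -> hilbert_entire (H x))
    (A_entire : forall x, I x -> entire (A x))
    (A_real : forall x, I x -> real_on_reals (A x))
    (A_even : forall x, I x -> even_fct (A x))
    (B_entire : forall x, I x -> entire (B x))
    (B_real : forall x, I x -> real_on_reals (B x))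
    (B_odd : forall x, I x -> odd_fct (B x))
    (Z_eval : forall x, I x -> evaluators (H x) (dbkernel (A x) (B x)))
    (A_derivable : forall x w, I x -> derivableC (fun t => A t w) x)
    (B_derivable : forall x w, I x -> derivableC (fun t => B t w) x)
    (A_ode : forall x w, I x ->
      deriveC (fun t => A t w) x - (mu x)%:C * A x w = - (w * B x w))
    (B_ode : forall x w, I x ->
      deriveC (fun t => B t w) x + (mu x)%:C * B x w = w * A x w)
    (* the derivatives occurring in the Wronskians exist *)
    (A_smooth : forall w, derivableC_upto n I (fun t => A t w))
    (B_smooth : forall w, derivableC_upto n I (fun t => B t w))
    (s_imaginary : forall i, complex.Re (s i) = 0)
    (s_distinct : forall i j, i != j -> s i != s j)
    (s_not_opp : forall i j, s i != - s j)
    (Z_indep : forall x, I x ->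
      linearly_independent (fun i => dbkernel (A x) (B x) (s i))) :
  forall x, I x ->
    let As := transformed s A x in
    let Bs := transformed s B x in
    let K := dbkernel As Bs in
    [/\ (* the denominators do not vanish *)
        wronskian_of A s x != 0 /\ wronskian_of B s x != 0,
        evaluators (modified s (H x)) K,
        forall z w, K z w = fprod (modified s (H x)) (K w) (K z),
        [/\ entire As, real_on_reals As & even_fct As]
      & [/\ entire Bs, real_on_reals Bs & odd_fct Bs]].
Proof.
have sP : admissible s.
  split=> [i|i j /eqP|//]; last by apply: contraTeq => /s_distinct.
  by have := s_imaginary i; case: (s i) => a b /= ->; apply/eqP; rewrite eq_complex /= oppr0 !eqxx.
have D t : I t -> kernel_space (H t) (A t) (B t).
  by move=> It; split; [exact: H_hilbert|exact: A_entire|exact: B_entire|exact: Z_eval].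
have par t : I t -> parity 1 (A t) (B t).
  move=> It; split=> [|w|w]; first exact: oner_neq0.
    by rewrite mul1r A_even.
  by rewrite mul1r B_odd.
pose m t : R[i] := (mu t)%:C.
have dA t w : I t -> is_deriveC (fun t => A t w) t (m t * A t w - w * B t w).
  move=> It; have := derivableC_is_derive (A_derivable t w It).
  by congr (is_deriveC _ _ _); rewrite -A_ode// addrC subrK.
have dB t w : I t -> is_deriveC (fun t => B t w) t (- m t * B t w + w * A t w).
  move=> It; have := derivableC_is_derive (B_derivable t w It).
  by congr (is_deriveC _ _ _); rewrite -B_ode// addrCA mulNr addNr addr0.
(* [mu] is the quotient of [A' + w B] by [A] at the point [w] of index 0 of
   sigma, where [A] does not vanish for any value of the parameter. *)
have m_smooth : derivableC_upto n.-1 I m.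
  case: n s A_smooth B_smooth Z_indep sP {s_imaginary s_distinct s_not_opp} => [|n'] s' AS BS Zi sP'.
    exact: derivableC_upto0.
  have A0 t : I t -> A t (s' ord0) != 0.
    by move=> It; exact: (sigma_neq0 (D t It) sP' (Zi t It) ord0).1.
  have /derivableC_uptoS[_ A1] := AS (s' ord0).
  have h1 := derivableC_upto_mul I_open
    (@derivableC_upto_cst _ _ I_open n' (s' ord0)) (derivableC_upto_le (leqnSn n') (BS (s' ord0))).
  have h2 := derivableC_upto_inv I_open A0 (derivableC_upto_le (leqnSn n') (AS (s' ord0))).
  have := derivableC_upto_mul I_open (derivableC_upto_add I_open A1 h1) h2.
  apply: (derivableC_upto_ext I_open) => t It.
  have := A_ode t (s' ord0) It => /eqP; rewrite subr_eq => /eqP ->.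
  rewrite addrAC addNr add0r mulfK//; exact: A0.
(* The swapped pair [(B, - A)] satisfies the system with [- mu]. *)
have mN_smooth : derivableC_upto n.-1 I (fun t => - m t).
  have := derivableC_upto_mul I_open (@derivableC_upto_cst _ _ I_open n.-1 (-1)) m_smooth.
  by apply: (derivableC_upto_ext I_open) => t _; rewrite mulN1r.
have dB' t w : I t -> is_deriveC (fun t => B t w) t (- m t * B t w - w * - A t w).
  by move=> It; rewrite mulrN opprK; exact: dB.
have dA' t w : I t -> is_deriveC (fun t => - A t w) t (- - m t * - A t w + w * B t w).
  move=> It; have := is_deriveC_mul (is_deriveC_cst (-1) t) (dA t w It).
  have -> : (fun t => -1 * A t w) = (fun t => - A t w) by apply/funext => ?; rewrite mulN1r.
  by congr (is_deriveC _ _ _); ring.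
move=> x Ix /=.
have indep' : linearly_independent (fun i => dbkernel (B x) (fun w => - A x w) (s i)).
  by rewrite dbkernel_swap; exact: Z_indep.
have D' := kernel_space_swap (D x Ix).
have par' := parity_swap (par x Ix).
have WA k (s' : 'I_k -> R[i]) kn := @wronskian_chain _ _ I_open n A B m dA dB m_smooth k s' x kn Ix.
have WB k (s' : 'I_k -> R[i]) kn := @wronskian_chain _ _ I_open n B
  (fun t w => - A t w) (fun t => - m t) dB' dA' mN_smooth k s' x kn Ix.
have -> : transformed s A x = chain_transform (A x) (B x) s.
  by rewrite /transformed /chain_transform; congr fill; apply/funext => w; rewrite !WA.
have -> : transformed s B x = chain_transform (B x) (fun w => - A x w) s.
  by rewrite /transformed /chain_transform; congr fill; apply/funext => w; rewrite !WB.
have ev := modified_evaluators (D x Ix) sP (Z_indep x Ix) (par x Ix).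
split.
- split; first by rewrite WA//; exact: (det_echain_mx (D x Ix) sP (Z_indep x Ix) (par x Ix)).
  by rewrite WB//; exact: (det_echain_mx D' sP indep' par').
- exact: ev.
- by move=> z w; apply: ev.2; exact: ev.1.
- split; first exact: (chain_transform_entire (D x Ix) sP (Z_indep x Ix) (par x Ix)).
    apply: (chain_transform_real (D x Ix) sP (Z_indep x Ix) (par x Ix)); [exact: A_real|exact: B_real].
  by move=> w; rewrite (chain_transform_opp (D x Ix) sP (Z_indep x Ix) (par x Ix)) mul1r.
split; first exact: (chain_transform_entire D' sP indep' par').
  apply: (chain_transform_real D' sP indep' par'); first exact: B_real.
  by move=> t; rewrite -[LHS]opprK; have := A_real x Ix t;
     case: (A x _) => a b /= ->; rewrite !oppr0.
by move=> w; rewrite (chain_transform_opp D' sP indep' par') mulN1r.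
Qed.
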